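(* Let $Y$ be a random variable with a probability density function $\rho_Y$ on $\mathbb{R}^+=[0,\infty)$ such that, for some real numbers $0<a<1<b$, the function $x\mapsto x^{z-1}\rho_Y(x)$, $x\ge 0$, is integrable for every $z\in\mathbb{C}$ in the strip $a<\Re(z)<b$. Suppose that for some $\beta\in(0,1)$ $$Y\overset{\mathcal{L}}{=}Y^{\beta}\,Y_{\beta},$$ where $Y_\beta$ is a positive random variable, independent of $Y$, with density $M_\beta(t)$, $t\ge0$. Then $Y\overset{\mathcal{L}}{=}Y_0$, where $Y_0$ is an exponential random variable with density $e^{-x}$, $x\ge 0$.
   Context: $\overset{\mathcal{L}}{=}$ denotes equality in law. For $0<\beta<1$, the $M$-Wright function is the entire function $$M_{\beta}(z):=\sum_{n=0}^{\infty}\frac{(-z)^{n}}{n!\,\Gamma(1-\beta(n+1))},$$ with the convention $1/\Gamma(x)=0$ when $x\in\{0,-1,-2,\dots\}$. It is a known fact that $M_\beta$ is nonnegative on $[0,\infty)$ and integrates to $1$ there, so it is a probability density on $[0,\infty)$. *)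

(* Defs.v *)
From HB Require Import structures.
From mathcomp Require Import all_boot all_order all_algebra complex.
From mathcomp Require Import all_classical all_reals all_analysis.
From mathcomp Require Import measurable_realfun.

Set Implicit Arguments.
Unset Strict Implicit.
Unset Printing Implicit Defensive.
Import Order.TTheory GRing.Theory Num.Theory.
Import numFieldNormedType.Exports.

Local Open Scope classical_set_scope.
Local Open Scope ring_scope.
Local Open Scope complex_scope.

(* x ^ z = exp (z ln x) for x > 0; the value at x = 0 is a convention, and it is
   irrelevant for integrability *)
Definition cpowR (R : realType) (x : R) (z : R[i]) : R[i] :=
  (x `^ complex.Re z)%:C * (cos (complex.Im z * ln x) +i* sin (complex.Im z * ln x)).

Definition cintegrable (R : realType) (D : set R) (f : R -> R[i]) : Prop :=
  lebesgue_measure.-integrable D (fun x => (complex.Re (f x))%:E) /\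
  lebesgue_measure.-integrable D (fun x => (complex.Im (f x))%:E).

Definition euler_gamma (R : realType) (x : R) : R :=
  \int[lebesgue_measure]_(t in `]0, +oo[) (t `^ (x - 1) * expR (- t)).

(* For x <= 0, the recurrence Gamma(x + 1) = x Gamma(x) is iterated up to a
   positive argument.  If x is 0, -1, -2, ..., the denominator vanishes and
   Gamma x = 0, hence (Gamma x)^-1 = 0: this is the convention 1/Gamma(x) = 0
   at the poles. *)
Definition Gamma (R : realType) (x : R) : R :=
  if 0 < x then euler_gamma x
  else let n := (Num.truncn (- x)).+1 in
       euler_gamma (x + n%:R) / \prod_(i < n) (x + i%:R).

Definition M_Wright (R : realType) (beta x : R) : R :=
  limn (series (fun n : nat =>
    (- x) ^+ n / (n`!%:R * Gamma (1 - beta * n.+1%:R)))).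

Definition has_density (R : realType) (d : measure_display)
    (T : measurableType d) (P : probability T R)
    (X : {RV P >-> R}) (f : R -> R) : Prop :=
  [/\ measurable_fun (`[0, +oo[ : set R) f,
      forall x, 0 <= x -> 0 <= f x &
      forall A : set R, measurable A ->
        distribution P X A =
        (\int[lebesgue_measure]_(x in A `&` `[0%R, +oo[) (f x)%:E)%E].

Definition independent_RV (R : realType) (d : measure_display)
    (T : measurableType d) (P : probability T R) (X Z : {RV P >-> R}) : Prop :=
  forall A B : set R, measurable A -> measurable B ->
    P (X @^-1` A `&` Z @^-1` B) = (P (X @^-1` A) * P (Z @^-1` B))%E.

Definition eq_law (R : realType) (d d' : measure_display)
    (T : measurableType d) (T' : measurableType d')
    (P : probability T R) (P' : probability T' R)
    (X : {RV P >-> R}) (X' : {RV P' >-> R}) : Prop :=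
  forall A : set R, measurable A -> distribution P X A = distribution P' X' A.

Definition powR_RV (R : realType) (d : measure_display)
    (T : measurableType d) (P : probability T R) (X : {RV P >-> R}) (p : R) :
    T -> R :=
  fun w => X w `^ p.

Lemma measurable_powR_RV (R : realType) (d : measure_display)
    (T : measurableType d) (P : probability T R) (X : {RV P >-> R}) (p : R) :
  measurable_fun setT (powR_RV X p).
Proof. exact: (measurableT_comp (measurable_powR p)). Qed.

HB.instance Definition _ (R : realType) (d : measure_display)
    (T : measurableType d) (P : probability T R) (X : {RV P >-> R}) (p : R) :=
  isMeasurableFun.Build _ _ _ _ (powR_RV X p) (measurable_powR_RV X p).

(* Main.v *)
(* Averaging over ln Y_beta contracts Lipschitz functions: the identity
   ln Y = beta ln Y + ln Y_beta in law, with independent terms, replaces a bounded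
   Lipschitz test function of ln Y by one whose Lipschitz constant is beta times
   smaller. Iterating, the law of Y is determined by that of Y_beta, and it remains
   to see that the exponential law is a solution, i.e. that
   int M_beta(t) exp(-(x/t)^(1/beta)) dt = exp(-x) for x > 0.

   This is the Post-Widder inversion of the completely monotone function
   exp(-s^beta). Its derivatives yield explicit probability densities
   q_K(w) = p_K(w) exp(-w), with p_K a polynomial with nonnegative coefficients,
   such that int_x^oo q_K(w) (1 - (x/w)^(1/beta))^K dw = exp(-x). After rescaling w
   by (K+1)^beta, the power series coefficients of q_K converge to those of M_beta
   by Gauss's limit formula for 1/Gamma. All the densities have mass 1, so Fatou's
   lemma, applied to the integrand and to its complement, gives the limit of the
   integrals. *)
Require Import Defs.
From HB Require Import structures.
From mathcomp Require Import all_boot all_order all_algebra complex.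
From mathcomp Require Import all_classical all_reals all_analysis.
From mathcomp Require Import measurable_realfun.
From mathcomp Require Import ring lra.
Set Implicit Arguments.
Unset Strict Implicit.
Unset Printing Implicit Defensive.
Import Order.TTheory GRing.Theory Num.Theory.
Import numFieldNormedType.Exports.
Local Open Scope classical_set_scope.
Local Open Scope ring_scope.
Local Open Scope complex_scope.

(** * The Gamma integral *)

(** The series of [M_Wright] cannot be integrated termwise against exp(-(x/t)^(1/beta)): this factor
    tends to 1 at infinity, so no single term is integrable. Hence the detour through densities
    whose integrals are known in closed form. The identity for q_K is Taylor's formula with integral
    remainder, expanded at infinity, for E(s) = exp(-s^beta): E(s0) is the integral over s > s0 of
    (s - s0)^K / K! times (-1)^(K+1) times the (K+1)-st derivative of E. Substituting s0 =
    x^(1/beta) and w = s^beta, and factoring out s^K, leaves the weight q_K(w) and the kernel (1 -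
    (x/w)^(1/beta))^K; the case s0 = 0 says that q_K has mass 1. Instead of differentiating E
    repeatedly, the proof generates the polynomials by a recursion and checks an explicit primitive.
    The scale (K+1)^beta is forced by the kernel: for w = (K+1)^beta * r it becomes (1 - c/(K+1))^K
    with c = (x/r)^(1/beta), which tends to exp(-c). About Gamma, Gauss's formula only requires the
    recurrence and the inequality Gamma(c + s) <= c^s Gamma(c) for 0 <= s <= 1. *)

Lemma cvgy_exprM_expRN (R : realType) (n : nat) :
  (x : R) ^+ n * expR (- x) @[x --> +oo] --> (0 : R).
Proof.
have xinv : (n.+1)`!%:R * x^-1 @[x --> +oo] --> (0 : R).
  rewrite -[X in _ --> X](mulr0 ((n.+1)`!%:R : R)).
  apply: cvgM; first exact: cvg_cst.
  by apply/gtr0_cvgV0; [exact: nbhs_pinfty_gt|exact: cvg_id].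
apply: (squeeze_cvgr _ (@cvg_cst _ (0 : R) _ _ _) xinv).
near=> x.
have x0 : 0 < x by near: x; exact: nbhs_pinfty_gt.
apply/andP; split; first by rewrite mulr_ge0 ?expR_ge0 ?exprn_ge0 ?(ltW x0).
have h : x ^+ n.+1 / n.+1`!%:R <= expR x.
  by rewrite (le_trans _ (expR_ge1Dxn n (ltW x0)))// lerDr.
rewrite expRN ler_pdivrMr ?expR_gt0// mulrAC ler_pdivlMr// -exprSr.
by rewrite mulrC -ler_pdivrMr ?ltr0n ?fact_gt0.
Unshelve. all: by end_near. Qed.

Lemma cvgy_horner_expRN (R : realType) (p : {poly R}) :
  p.[x] * expR (- x) @[x --> +oo] --> (0 : R).
Proof.
have H : \sum_(i < size p) (p`_i * (x ^+ i * expR (- x))) @[x --> +oo] -->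
    \sum_(i < size p) (p`_i * (0 : R)).
  apply: cvg_big => [|i _]; first exact: add_continuous.
  by apply: cvgM; [exact: cvg_cst|exact: cvgy_exprM_expRN].
move: H; rewrite big1; last by move=> i _; rewrite mulr0.
apply: cvg_trans; apply: near_eq_cvg; apply: nearW => x.
by rewrite horner_coef mulr_suml; apply: eq_bigr => i _; rewrite mulrA.
Qed.

(** Extended-real valued, so that the recurrence and the interpolation bound can be proved by
    integration of nonnegative functions before finiteness is known; finiteness is then deduced from
    them. *)
Definition gamma_integral (R : realType) (y : R) : \bar R :=
  (\int[lebesgue_measure]_(t in `]0%R, +oo[) (t `^ (y - 1) * expR (- t))%:E)%E.

Lemma euler_gammaE (R : realType) (y : R) :
  euler_gamma y = fine (gamma_integral y).
Proof. by []. Qed.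

Lemma measurable_gamma_integrand (R : realType) (y : R) (D : set R) :
  measurable_fun D (fun t : R => (t `^ y * expR (- t))%:E).
Proof.
apply/measurable_EFinP; apply: measurable_funTS; apply: measurable_funM.
  exact: measurable_powR.
apply: measurableT_comp => //; exact: measurable_funP.
Qed.

Lemma gamma_integral_ge0 (R : realType) (y : R) : (0 <= gamma_integral y)%E.
Proof.
by apply: integral_ge0 => t _; rewrite lee_fin mulr_ge0 ?powR_ge0 ?expR_ge0.
Qed.

Lemma gamma_integral1 (R : realType) : gamma_integral (1 : R) = 1%E.
Proof.
rewrite /gamma_integral subrr.
under eq_integral do rewrite powRr0 mul1r.
rewrite integral_itv_obnd_cbnd//; last first.
  apply/measurable_EFinP; apply: measurable_funTS.
  apply: measurableT_comp => //.
rewrite (@ge0_continuous_FTC2y _ _ (fun x => - expR (- x)) 0 0)//.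
- by rewrite oppr0 expR0 EFinN oppeK add0e.
- apply: continuous_subspaceT => x.
  by apply: continuous_comp; [exact: opp_continuous|exact: continuous_expR].
- rewrite -oppr0; apply: cvgN; exact: cvgr_expR.
- by apply/cvg_at_right_filter; apply: cvgN;
    apply: continuous_comp; [exact: opp_continuous|exact: continuous_expR].
- move=> x _; rewrite derive1E; apply: (@derive_val _ _ _ _ _ _ _ _).
  by apply: trigger_derive; rewrite /GRing.scale /=; ring.
Qed.

Lemma cvgy_powRM_expRN (R : realType) (y : R) :
  (t : R) `^ y * expR (- t) @[t --> +oo] --> (0 : R).
Proof.
apply: (squeeze_cvgr _ (@cvg_cst _ (0 : R) _ _ _)
  (@cvgy_exprM_expRN R (Num.truncn y).+1)).
near=> t.
have t1 : 1 <= t by near: t; exact: nbhs_pinfty_ge.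
rewrite mulr_ge0 ?powR_ge0 ?expR_ge0//= ler_wpM2r ?expR_ge0//.
by rewrite -powR_mulrn ?(le_trans ler01)// ler_powR// ltW// truncnS_gt.
Unshelve. all: by end_near. Qed.

Lemma gamma_integralS (R : realType) (y : R) : 0 < y ->
  gamma_integral (y + 1) = (y%:E * gamma_integral y)%E.
Proof.
move=> y0.
(* Integration by parts is done away from 0, where the powers may be singular. The bound n+2 keeps
   the endpoints distinct even for n = 0. *)
pose D (n : nat) : set R := `[(n.+2%:R)^-1, n.+2%:R]%classic.
have D0 n x : D n x -> 0 < x.
  by rewrite /D/= in_itv/= => /andP[+ _]; apply: lt_le_trans; rewrite invr_gt0.
have DU : \bigcup_n D n = `]0, +oo[%classic.
  apply/seteqP; split => x /=; first by move=> [n _ /D0 x0]; rewrite in_itv/= x0.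
  rewrite in_itv/= andbT => x0.
  exists (Num.truncn (x + x^-1)) => //; rewrite /D/= in_itv/=.
  have := truncnS_gt (x + x^-1); set m := Num.truncn _ => /ltW h.
  have xV0 : 0 < x^-1 by rewrite invr_gt0.
  have mm : (m.+1%:R <= m.+2%:R :> R) by rewrite ler_nat.
  apply/andP; split; last by rewrite (le_trans _ mm)// (le_trans _ h)// lerDl ltW.
  rewrite -[leRHS]invrK lef_pV2 ?posrE ?invr_gt0//.
  by rewrite (le_trans _ mm)// (le_trans _ h)// lerDr ltW.
have ndD : nondecreasing_seq D.
  apply/nondecreasing_seqP => n; rewrite subsetEset => x.
  rewrite /D/= !in_itv/= => /andP[xl xr]; apply/andP; split.
    by rewrite (le_trans _ xl)// lef_pV2 ?posrE// ler_nat.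
  by rewrite (le_trans xr)// ler_nat.
have cvgD (z : R) : (\int[lebesgue_measure]_(t in D n) (t `^ z * expR (- t))%:E)%E
    @[n --> \oo] --> gamma_integral (z + 1).
  rewrite /gamma_integral -DU addrK.
  apply: ge0_nondecreasing_set_cvg_integral => //.
  - by move=> n; exact: measurable_itv.
  - by move=> n; exact: measurable_gamma_integrand.
  - by move=> n x _; rewrite lee_fin mulr_ge0 ?powR_ge0 ?expR_ge0.
have parts n : (\int[lebesgue_measure]_(t in D n) (t `^ y * expR (- t))%:E =
    (n.+2%:R^-1 `^ y * expR (- n.+2%:R^-1) - n.+2%:R `^ y * expR (- n.+2%:R))%:E +
    y%:E * \int[lebesgue_measure]_(t in D n) (t `^ (y - 1) * expR (- t))%:E)%E.
  have ab : n.+2%:R^-1 < n.+2%:R :> R.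
    by rewrite (@lt_trans _ _ 1)// ?invf_lt1// ltr1n.
  have Fd (z x : R) : 0 < x -> {for x, continuous (fun t : R => t `^ z)}.
    move=> x0; apply: differentiable_continuous; apply/derivable1_diffP.
    by apply: derivable_powR; rewrite in_itv/= x0.
  have a0 : 0 < (n.+2%:R^-1 : R) by rewrite invr_gt0.
  rewrite (@integration_by_parts R (fun t => t `^ y) (fun t => - expR (- t))
    (fun t => y * t `^ (y - 1)) (fun t => expR (- t)))//.
  - rewrite (_ : (fun x : R => (y * x `^ (y - 1) * - expR (- x))%:E) =
                 (fun x => - (y%:E * (x `^ (y - 1) * expR (- x))%:E))%E); last first.
      by apply/funext => x; rewrite -EFinM -EFinN; congr EFin; ring.
    rewrite integral_ge0N; last first.
      by move=> x _; rewrite lee_fin !mulr_ge0 ?powR_ge0 ?expR_ge0 ?ltW.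
    rewrite ge0_integralZl_EFin ?ltW//; last 2 first.
      by move=> x _; rewrite lee_fin mulr_ge0 ?powR_ge0 ?expR_ge0.
      exact: measurable_gamma_integrand.
    by rewrite oppeK; congr (_%:E + _)%E; ring.
  - apply: derivable_within_continuous => x.
    rewrite in_itv/= => /andP[/(lt_le_trans a0) x0 _].
    by apply: derivableM => //; apply: derivable_powR; rewrite in_itv/= x0.
  - split.
    + move=> x; rewrite in_itv/= => /andP[/(lt_trans a0) x0 _].
      by apply: derivable_powR; rewrite in_itv/= x0.
    + by apply: cvg_at_right_filter; exact: Fd.
    + by apply: cvg_at_left_filter; exact: Fd.
  - move=> x; rewrite in_itv/= => /andP[/(lt_trans a0) x0 _].
    by rewrite powR_derive1// in_itv/= x0.
  - apply: continuous_subspaceT => x.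
    by apply: continuous_comp; [exact: opp_continuous|exact: continuous_expR].
  - have cE (x : R) : {for x, continuous (fun t : R => - expR (- t))}.
      by apply: cvgN; apply: continuous_comp;
        [exact: opp_continuous|exact: continuous_expR].
    split; [by []|apply: cvg_at_right_filter; exact: cE|apply: cvg_at_left_filter; exact: cE].
  - move=> x _; rewrite derive1E; apply: (@derive_val _ _ _ _ _ _ _ _).
    by apply: trigger_derive; rewrite /GRing.scale /=; ring.
have B0 : (n.+2%:R^-1 `^ y * expR (- n.+2%:R^-1) - n.+2%:R `^ y * expR (- n.+2%:R))%:E
    @[n --> \oo] --> (0%R : R)%:E.
  apply: cvg_EFin; first exact: nearW.
  have ny : (n.+2%:R : R) @[n --> \oo] --> +oo.
    apply/cvgryPge => M; near=> n; apply: (@le_trans _ _ n%:R).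
      by near: n; exact: nbhs_infty_ger.
    by rewrite ler_nat leqW.
  have nV : (n.+2%:R^-1 : R) @[n --> \oo] --> 0.
    by apply/gtr0_cvgV0 => //; exact: nearW.
  rewrite -[X in _ --> X](subrr (0 : R)); apply: cvgB.
    have nVy : (n.+2%:R^-1 : R) `^ y @[n --> \oo] --> 0.
      by apply: (cvg_at_rightP _ _ _).1 (powR_cvg0 y0) _ _; split.
    apply: (squeeze_cvgr _ (@cvg_cst _ (0 : R) _ _ _) nVy).
    apply: nearW => n; rewrite mulr_ge0 ?powR_ge0 ?expR_ge0//=.
    by rewrite ler_piMr ?powR_ge0// expR_le1 oppr_le0 invr_ge0.
  exact: (cvg_pinftyP _ _).1 (cvgy_powRM_expRN y) _ ny.
have c1 := cvgD y.
have c2 : (\int[lebesgue_measure]_(t in D n) (t `^ y * expR (- t))%:E)%E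
    @[n --> \oo] --> (y%:E * gamma_integral y)%E.
  under eq_fun do rewrite parts.
  rewrite -[(y%:E * gamma_integral _)%E]add0e; apply: cvgeD => //.
  by apply: cvgeZl => //; have := cvgD (y - 1); rewrite subrK.
exact: (cvg_unique _ c1 c2).
Unshelve. all: by end_near. Qed.

(** Weighted AM-GM for w and 1. After division by w^s it is the average, with weights s and 1 - s,
    of two instances of 1 + u <= exp(u) in which the terms in ln w cancel. *)
Lemma powR_le_tangent (R : realType) (w s : R) : 0 < w -> 0 <= s -> s <= 1 ->
  w `^ s <= s * w + (1 - s).
Proof.
move=> w0 s0 s1; rewrite /powR gt_eqF//.
set L := ln w; have wE : w = expR (s * L) * expR ((1 - s) * L).
  by rewrite -expRD -mulrDl subrKC mul1r lnK.
have h1 : 1 + (1 - s) * L <= expR ((1 - s) * L) by exact: expR_ge1Dx.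
have h2 : 1 - s * L <= expR (- (s * L)) by exact: expR_ge1Dx.
have -> : s * w + (1 - s) =
    expR (s * L) * (s * expR ((1 - s) * L) + (1 - s) * expR (- (s * L))).
  rewrite [in LHS]wE [in RHS]mulrDr !mulrA [X in _ = _ + X]mulrAC expRxMexpNx_1.
  by ring.
rewrite -[leLHS]mulr1 ler_wpM2l ?expR_ge0//.
have s1' : 0 <= 1 - s by rewrite subr_ge0.
have := lerD (ler_wpM2l s0 h1) (ler_wpM2l s1' h2).
by apply: le_trans; rewrite le_eqVlt; apply/orP; left; apply/eqP; ring.
Qed.

Lemma powR_le_tangent_at (R : realType) (c x s : R) :
  0 < c -> 0 < x -> 0 <= s -> s <= 1 ->
  x `^ s <= c `^ s * (1 - s) + c `^ s * s / c * x.
Proof.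
move=> c0 x0 s0 s1.
have -> : c `^ s * (1 - s) + c `^ s * s / c * x = c `^ s * (s * (x / c) + (1 - s)).
  by field; rewrite gt_eqF.
rewrite -{1}(divfK (lt0r_neq0 c0) x) powRM ?divr_ge0 ?(ltW c0) ?(ltW x0)// [leLHS]mulrC.
by rewrite ler_wpM2l ?powR_ge0 ?powR_le_tangent ?divr_gt0.
Qed.

(** The concave function t^s lies below its tangent at c, and this is integrated against t^(c-1)
    exp(-t). The point c is the mean of the Gamma law of parameter c, so the recurrence later
    collapses the right side to c^s Gamma(c). *)
Lemma gamma_integral_interp (R : realType) (c s : R) : 0 < c -> 0 <= s <= 1 ->
  (gamma_integral (c + s) <=
   (c `^ s * (1 - s))%:E * gamma_integral c + (c `^ s * s / c)%:E * gamma_integral (c + 1))%E.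
Proof.
move=> c0 /andP[s0 s1].
have mgi (z : R) : measurable_fun (`]0, +oo[ : set R)
  (fun t : R => (t `^ z * expR (- t))%:E) by exact: measurable_gamma_integrand.
have k1 : 0 <= c `^ s * (1 - s) by rewrite mulr_ge0 ?powR_ge0 ?subr_ge0.
have k2 : 0 <= c `^ s * s / c by rewrite !mulr_ge0 ?powR_ge0// invr_ge0 ltW.
have g0 (z x : R) : (0 <= (x `^ z * expR (- x))%:E)%E.
  by rewrite lee_fin mulr_ge0 ?powR_ge0 ?expR_ge0.
have Z (k z : R) : 0 <= k -> (k%:E * gamma_integral z)%E =
    (\int[lebesgue_measure]_(t in `]0%R, +oo[) (k%:E * (t `^ (z - 1) * expR (- t))%:E))%E.
  move=> k0; rewrite ge0_integralZl_EFin//. exact: mgi.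
rewrite !Z//.
rewrite [X in (X <= _)%E]/gamma_integral -ge0_integralD//; last 4 first.
- by move=> x _; rewrite mule_ge0.
- by apply: measurable_funeM; exact: mgi.
- by move=> x _; rewrite mule_ge0.
- by apply: measurable_funeM; exact: mgi.
apply: ge0_le_integral => //.
- exact: mgi.
- by apply: emeasurable_funD; apply: measurable_funeM; exact: mgi.
- move=> x /=; rewrite in_itv/= andbT => x0.
  rewrite -!EFinM -EFinD lee_fin.
  have xc : x `^ (c + s - 1) = x `^ (c - 1) * x `^ s.
    by rewrite -powRD ?(gt_eqF x0) ?implybT//; congr (_ `^ _); ring.
  have xc1 : x `^ (c + 1 - 1) = x `^ (c - 1) * x.
    have -> : c + 1 - 1 = c - 1 + 1 by ring.
    by rewrite powRD ?(gt_eqF x0) ?implybT// powRr1 ?ltW.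
  rewrite xc xc1.
  have tangent := powR_le_tangent_at c0 x0 s0 s1.
  have := ler_wpM2l (mulr_ge0 (powR_ge0 x (c - 1)) (expR_ge0 (- x))) tangent.
  rewrite mulrAC => /le_trans; apply.
  by rewrite le_eqVlt; apply/orP; left; apply/eqP; ring.
Qed.

(** For z in ]0, 1], interpolation between 1 and 2 bounds the integral at 1 + z, and the recurrence,
    with z > 0, carries finiteness down to z. Larger arguments are reached by the recurrence
    upwards. *)
Lemma gamma_integral_fin_num (R : realType) (y : R) : 0 < y ->
  gamma_integral y \is a fin_num.
Proof.
have base (z : R) : 0 < z <= 1 -> gamma_integral z \is a fin_num.
  move=> /andP[z0 z1]; have := @gamma_integral_interp R 1 z ltr01.
  rewrite (ltW z0) z1 => /(_ isT); rewrite gamma_integral1 (gamma_integralS ltr01).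
  rewrite gamma_integral1 addrC gamma_integralS// !mule1 -EFinD => h.
  rewrite ge0_fin_numE ?gamma_integral_ge0//.
  by rewrite ltey; apply/eqP => zoo; move: h; rewrite zoo gt0_muley ?lte_fin.
have step (n : nat) (z : R) : 0 < z <= n.+1%:R -> gamma_integral z \is a fin_num.
  elim: n z => [|n IH] z; first exact: base.
  move=> /andP[z0 zn]; have [z1|z1] := leP z 1; first by apply: base; rewrite z0.
  rewrite -(subrK 1 z) gamma_integralS ?subr_gt0//.
  apply: fin_numM => //; apply: IH; rewrite subr_gt0 z1/=.
  by rewrite lerBlDr natr1.
move=> y0; apply: (step (Num.truncn y)); rewrite y0/= ltW//.
exact: truncnS_gt.
Qed.

Lemma euler_gammaS (R : realType) (y : R) : 0 < y ->
  euler_gamma (y + 1) = y * euler_gamma y.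
Proof.
by move=> y0; rewrite !euler_gammaE gamma_integralS// fineM ?gamma_integral_fin_num.
Qed.

Lemma euler_gamma1 (R : realType) : euler_gamma (1 : R) = 1.
Proof. by rewrite euler_gammaE gamma_integral1. Qed.

Lemma euler_gamma_ge0 (R : realType) (y : R) : 0 <= euler_gamma y.
Proof. by rewrite euler_gammaE fine_ge0// gamma_integral_ge0. Qed.

(** Wendel's inequality, the source of all the asymptotics of Gamma below. *)
Lemma euler_gammaD_le (R : realType) (c s : R) : 0 < c -> 0 <= s <= 1 ->
  euler_gamma (c + s) <= c `^ s * euler_gamma c.
Proof.
move=> c0 s01; have /andP[s0 s1] := s01.
have c1 : 0 < c + 1 by rewrite addr_gt0.
have cs : 0 < c + s by rewrite ltr_wpDr.
have := gamma_integral_interp c0 s01.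
rewrite -(fineK (gamma_integral_fin_num c0)) -(fineK (gamma_integral_fin_num c1)).
rewrite -(fineK (gamma_integral_fin_num cs)) -!euler_gammaE euler_gammaS//.
rewrite -!EFinM -EFinD lee_fin => /le_trans; apply.
rewrite le_eqVlt; apply/orP; left; apply/eqP; field.
by rewrite gt_eqF.
Qed.

(** Wendel's inequality from y to 1 reads 1 <= y^(1-y) Gamma(y), which excludes the value 0. *)
Lemma euler_gamma_gt0 (R : realType) (y : R) : 0 < y <= 1 -> 0 < euler_gamma y.
Proof.
move=> /andP[y0 y1]; have := @euler_gammaD_le R y (1 - y) y0.
rewrite subr_ge0 y1 gerBl (ltW y0) => /(_ isT); rewrite subrKC euler_gamma1 => h.
rewrite lt_neqAle euler_gamma_ge0 andbT; apply: contraTneq h => <-.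
by rewrite mulr0 ler10.
Qed.

(** * Gauss's limit formula *)

(** Gauss's product for 1/Gamma(z) usually has K+1 factors and the base K. With K factors and the
    base K+1 it is exactly, at z = 1 - beta * (n+1), the coefficient of (-r)^n / n! in the rescaled
    density; see [wright_approx_lim]. *)
Definition gauss_recip_gamma (R : realType) (K : nat) (z : R) : R :=
  K.+1%:R `^ (1 - z) * (\prod_(i < K) (z + i%:R)) / K`!%:R.

Lemma euler_gamma_natr (R : realType) (n : nat) :
  euler_gamma (n.+1%:R : R) = n`!%:R.
Proof.
elim: n => [|n IH]; first by rewrite euler_gamma1.
by rewrite -natr1 euler_gammaS// IH -natrM factS.
Qed.

Lemma euler_gammaDn (R : realType) (y : R) (n : nat) : 0 < y ->
  euler_gamma (y + n%:R) = (\prod_(i < n) (y + i%:R)) * euler_gamma y.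
Proof.
move=> y0; elim: n => [|n IH]; first by rewrite big_ord0 mul1r addr0.
rewrite -natr1 addrA euler_gammaS ?ltr_wpDr// IH big_ord_recr/=; ring.
Qed.

Lemma cvg_natS_ratio (R : realType) (z : R) :
  (n.+1%:R / (n%:R + z) : R) @[n --> \oo] --> (1 : R).
Proof.
have h : ((n%:R + z)^-1 : R) @[n --> \oo] --> (0 : R).
  apply/gtr0_cvgV0.
    near=> n; rewrite -ltrBlDr sub0r; near: n; exact: nbhs_infty_gtr.
  apply/cvgryPge => M; near=> n; rewrite -lerBlDr; near: n.
  exact: nbhs_infty_ger.
have h1 : (1 + (1 - z) * (n%:R + z)^-1 : R) @[n --> \oo] --> (1 + (1 - z) * 0 : R).
  by apply: cvgD; [exact: cvg_cst|apply: cvgM => //; exact: cvg_cst].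
move: h1; rewrite mulr0 addr0; apply: cvg_trans; apply: near_eq_cvg.
near=> n.
have n0 : n%:R + z != 0.
  by rewrite gt_eqF// -ltrBlDr sub0r; near: n; exact: nbhs_infty_gtr.
by rewrite -natr1; field.
Unshelve. all: by end_near. Qed.

(** Wendel's inequality, used from n + y to n + 1 and from n to n + y, squeezes the product with
    Gamma(y) between 1 and (n+1)/n. *)
Lemma cvg_gauss_euler_gamma (R : realType) (y : R) : 0 < y <= 1 ->
  gauss_recip_gamma n y @[n --> \oo] --> (euler_gamma y)^-1.
Proof.
move=> y01; have /andP[y0 y1] := y01; have G0 := euler_gamma_gt0 y01.
have s01 : 0 <= 1 - y <= 1 by rewrite subr_ge0 y1 gerBl ltW.
suff h : gauss_recip_gamma n y * euler_gamma y @[n --> \oo] --> (1 : R).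
  have : gauss_recip_gamma n y * euler_gamma y * (euler_gamma y)^-1
      @[n --> \oo] --> 1 * (euler_gamma y)^-1.
    by apply: cvgM => //; exact: cvg_cst.
  rewrite mul1r; apply: cvg_trans; apply: near_eq_cvg; apply: nearW => n.
  by rewrite mulfK// gt_eqF.
apply: (squeeze_cvgr _ (@cvg_cst _ (1 : R) _ _ _) (@cvg_natS_ratio R 0)).
near=> n.
have n0 : (0 < n)%N by near: n; exact: nbhs_infty_gt.
have -> : gauss_recip_gamma n y * euler_gamma y =
    n.+1%:R `^ (1 - y) * euler_gamma (y + n%:R) / n`!%:R.
  by rewrite /gauss_recip_gamma euler_gammaDn//; ring.
have f0 : 0 < n`!%:R :> R by rewrite ltr0n fact_gt0.
apply/andP; split.
  rewrite ler_pdivlMr// mul1r -euler_gamma_natr.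
  have yn : 0 < y + n%:R by rewrite ltr_wpDr.
  have := euler_gammaD_le yn s01.
  have -> : y + n%:R + (1 - y) = n.+1%:R by rewrite -natr1; ring.
  move=> /le_trans; apply; rewrite ler_wpM2r ?euler_gamma_ge0//.
  rewrite ge0_ler_powR ?nnegrE ?(andP s01).1 ?(ltW yn)// -natr1 addrC.
  by rewrite lerD2l.
have nR : 0 < n%:R :> R by rewrite ltr0n.
have := @euler_gammaD_le R n%:R y nR; rewrite (ltW y0) y1 => /(_ isT) h.
have fE : n`!%:R = n%:R * (n.-1)`!%:R :> R.
  by rewrite -natrM -[in LHS](prednK n0) factS prednK.
have nE : euler_gamma (n%:R : R) = (n.-1)`!%:R by rewrite -euler_gamma_natr prednK.
rewrite addr0 ler_pdivrMr// fE mulrA divfK ?lt0r_neq0// -nE.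
rewrite [X in _ <= X * _](_ : _ = n.+1%:R `^ (1 - y) * n.+1%:R `^ y); last first.
  by rewrite -powRD ?subrK ?powRr1// pnatr_eq0 implybT.
rewrite -[leRHS]mulrA ler_wpM2l ?powR_ge0// addrC (le_trans h)//.
rewrite ler_wpM2r ?euler_gamma_ge0// ge0_ler_powR ?nnegrE ?(ltW y0)//.
by rewrite ler_nat.
Unshelve. all: by end_near. Qed.

Lemma gauss_recip_gammaS (R : realType) (n : nat) (z : R) : n%:R + z != 0 ->
  gauss_recip_gamma n z = z * (n.+1%:R / (n%:R + z)) * gauss_recip_gamma n (z + 1).
Proof.
move=> nz; have P : (\prod_(i < n) (z + i%:R)) * (n%:R + z) =
    z * \prod_(i < n) (z + 1 + i%:R).
  rewrite [n%:R + z]addrC -(big_ord_recr n (fun i => z + i%:R))/= big_ord_recl addr0.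
  by congr (_ * _); apply: eq_bigr => i _; rewrite -addrA nat1r.
have n1 : n.+1%:R != 0 :> R by rewrite pnatr_eq0.
rewrite /gauss_recip_gamma.
have -> : \prod_(i < n) (z + i%:R) = z * (\prod_(i < n) (z + 1 + i%:R)) / (n%:R + z).
  by rewrite -P mulfK.
have -> : (n.+1%:R `^ (1 - z) : R) = n.+1%:R * n.+1%:R `^ (1 - (z + 1)).
  rewrite -[X in X * _]powRr1// -powRD ?n1 ?implybT//; congr (_ `^ _); ring.
field.
by rewrite nz pnatr_eq0 -lt0n fact_gt0.
Qed.

(** Follows 1/Gamma(z) = z / Gamma(z + 1). The factors z + i multiply the limit, so they may vanish
    and the poles of Gamma need no separate treatment. *)
Lemma cvg_gauss_recip_gamma_shift (R : realType) (n : nat) (z l : R) :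
  gauss_recip_gamma k (z + n%:R) @[k --> \oo] --> l ->
  gauss_recip_gamma k z @[k --> \oo] --> (\prod_(i < n) (z + i%:R)) * l.
Proof.
elim: n z l => [|n IH] z l; first by rewrite addr0 big_ord0 mul1r.
rewrite -nat1r addrA => /IH h.
rewrite big_ord_recl addr0 -mulrA.
under eq_bigr => i _ do rewrite /= /bump /= -nat1r addrA.
have h2 : z * (k.+1%:R / (k%:R + z)) * gauss_recip_gamma k (z + 1)
    @[k --> \oo] --> z * 1 * ((\prod_(i < n) (z + 1 + i%:R)) * l).
  by apply: cvgM => //; apply: cvgM; [exact: cvg_cst|exact: cvg_natS_ratio].
move: h2; rewrite mulr1; apply: cvg_trans; apply: near_eq_cvg.
near=> k; apply/esym/gauss_recip_gammaS.
by rewrite gt_eqF// -ltrBlDr sub0r; near: k; exact: nbhs_infty_gtr.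
Unshelve. all: by end_near. Qed.

Lemma cvg_gauss_Gamma (R : realType) (z : R) : z <= 1 ->
  gauss_recip_gamma n z @[n --> \oo] --> (Gamma z)^-1.
Proof.
move=> z1; rewrite /Gamma; case: ifPn => [z0|].
  by apply: cvg_gauss_euler_gamma; rewrite z0.
(* Inverting the quotient is also valid at a pole: the product is 0, and both sides are 0 by the
   default value of division. The shift by the truncation of -z plus one brings z into ]0, 1], and 1
   is attained exactly at the poles. *)
rewrite -leNgt => z0; rewrite /= invf_div.
apply: cvg_gauss_recip_gamma_shift; apply: cvg_gauss_euler_gamma.
have Nz0 : 0 <= - z by rewrite oppr_ge0.
have /andP[h1 h2] := truncn_itv Nz0.
apply/andP; split; first by rewrite -ltrBlDl sub0r.
by rewrite -natr1 addrA gerDr -lerBrDl sub0r.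
Qed.

(** * The approximating densities *)

(* With [E s := expR (- s `^ beta)] and [w := s `^ beta], the value of
   [expR (- w) * (wright_poly beta K).[w]] is
   [(-1) ^+ K.+1 * E^`(K.+1) s * s `^ (K.+1%:R - beta) / (beta * K`!%:R)]. *)
Fixpoint wright_poly (R : realType) (beta : R) (K : nat) : {poly R} :=
  if K is k.+1 then
    let p := wright_poly beta k in
    p - (beta / k.+1%:R) *: (('X * p)^`() - 'X * p)
  else 1.

Lemma coef_wright_polyS (R : realType) (beta : R) (k i : nat) :
  (wright_poly beta k.+1)`_i =
  (1 - beta * i.+1%:R / k.+1%:R) * (wright_poly beta k)`_i +
  beta / k.+1%:R * (if i is j.+1 then (wright_poly beta k)`_j else 0).
Proof.
rewrite /= coefB coefZ coefB coef_deriv !coefXM/= -mulr_natr.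
by case: i => [|i]/=; ring.
Qed.

Lemma size_wright_poly (R : realType) (beta : R) (k : nat) :
  (size (wright_poly beta k) <= k.+1)%N.
Proof.
elim: k => [|k IH]; first by rewrite /= size_poly1.
apply/leq_sizeP => -[//|j] kj; rewrite coef_wright_polyS.
by rewrite !(leq_sizeP _ _ IH) ?mulr0 ?addr0// ltnW.
Qed.

(** Algebraic form of the complete monotonicity of exp(-s^beta): in the recurrence, the factor 1 -
    beta * (i+1)/(k+1) can be negative only for i > k, where the degree bound makes the coefficient
    vanish. *)
Lemma coef_wright_poly_ge0 (R : realType) (beta : R) (k i : nat) :
  0 <= beta <= 1 -> 0 <= (wright_poly beta k)`_i.
Proof.
move=> /andP[b0 b1]; elim: k i => [|k IH] i; first by rewrite /= coef1 ler0n.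
rewrite coef_wright_polyS addr_ge0//; last first.
  by rewrite mulr_ge0 ?divr_ge0//; case: i.
have [ik|ki] := leqP i k; last first.
  by rewrite (leq_sizeP _ _ (size_wright_poly beta k)) ?mulr0.
rewrite mulr_ge0// subr_ge0 ler_pdivrMr// mul1r.
by rewrite (le_trans (ler_piMl _ b1))// ler_nat.
Qed.

Lemma horner_wright_poly_ge0 (R : realType) (beta w : R) (k : nat) :
  0 <= beta <= 1 -> 0 <= w -> 0 <= (wright_poly beta k).[w].
Proof.
move=> b w0; rewrite horner_coef sumr_ge0// => i _.
by rewrite mulr_ge0 ?exprn_ge0 ?coef_wright_poly_ge0.
Qed.

(** The coefficient of (-w)^n / n! in the power series of p(w) exp(-w): multiplication by w^i shifts
    the exponential series, which produces the sign and the falling factorial. *)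
Definition ffact_coef (R : realType) (p : {poly R}) (n : nat) : R :=
  \sum_(i < n.+1) p`_i * (-1) ^+ i * (n ^_ i)%:R.

(** The polynomial on the left corresponds to the derivative of w p(w) exp(-w), and the operator
    sending f to (w f)' multiplies w^n by n+1. *)
Lemma ffact_coef_deriv (R : realType) (p : {poly R}) (n : nat) :
  ffact_coef (('X * p)^`() - 'X * p) n = n.+1%:R * ffact_coef p n.
Proof.
rewrite /ffact_coef.
under eq_bigr => i _ do rewrite coefB coef_deriv !coefXM/= !mulrBl.
rewrite sumrB [X in _ - X]big_ord_recl/= !mul0r add0r.
rewrite (_ : \sum_(i < n) _ =
    - \sum_(i < n.+1) p`_i * (-1) ^+ i * (n ^_ i)%:R * (n - i)%:R).
  rewrite opprK -big_split/= mulr_sumr; apply: eq_bigr => i _.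
  have iLn : (i <= n)%N by rewrite -ltnS.
  rewrite natrB// -mulr_natr -!natr1; ring.
rewrite [in RHS]big_ord_recr/= subnn mulr0 addr0 -sumrN.
apply: eq_bigr => i _; rewrite /bump/= add1n ffactnSr natrM exprS; ring.
Qed.

(** On power series, each step of the recursion is diagonal, with eigenvalue 1 - beta * (n+1)/(k+1)
    on w^n. The product of these eigenvalues is Gauss's product at 1 - beta * (n+1), up to a power
    of K+1. *)
Lemma ffact_coef_wright_poly (R : realType) (beta : R) (k n : nat) :
  ffact_coef (wright_poly beta k) n = \prod_(i < k) (1 - beta * n.+1%:R / i.+1%:R).
Proof.
elim: k => [|k IH].
  rewrite big_ord0 /ffact_coef big_ord_recl big1/= ?addr0; last first.
    by move=> i _; rewrite coef1 !mul0r.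
  by rewrite coef1 ffactn0 !mulr1.
rewrite big_ord_recr/= -IH.
transitivity (ffact_coef (wright_poly beta k) n - beta / k.+1%:R *
    ffact_coef (('X * wright_poly beta k)^`() - 'X * wright_poly beta k) n).
  rewrite /ffact_coef mulr_sumr -sumrB; apply: eq_bigr => i _.
  by rewrite coefB coefZ; ring.
rewrite ffact_coef_deriv; ring.
Qed.

Lemma cvg_series_ffact (R : realType) (w : R) (i : nat) :
  series (fun n => (- w) ^+ n / n`!%:R * ((-1) ^+ i * (n ^_ i)%:R)) n
    @[n --> \oo] --> w ^+ i * expR (- w).
Proof.
elim: i => [|i IH].
  rewrite expr0 mul1r /expR.
  under eq_fun do rewrite /series/=.
  have := is_cvg_series_exp_coeff (- w); apply: cvg_trans; apply: near_eq_cvg.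
  apply: nearW => n; rewrite /series /=; apply: eq_bigr => j _.
  by rewrite ffactn0 !mulr1 /exp_coeff.
rewrite -cvg_shiftS/=.
have : w * series (fun n => (- w) ^+ n / n`!%:R * ((-1) ^+ i * (n ^_ i)%:R)) n
    @[n --> \oo] --> w * (w ^+ i * expR (- w)).
  by apply: cvgM => //; exact: cvg_cst.
rewrite mulrA -exprS; apply: cvg_trans; apply: near_eq_cvg; apply: nearW => n.
rewrite /series/= big_nat_recl// ffact0n !mulr0 add0r mulr_sumr.
apply: eq_bigr => j _; rewrite ffactSS factS !natrM !exprS; field.
by rewrite pnatr_eq0 -lt0n fact_gt0 addrC natr1 pnatr_eq0.
Qed.

Lemma cvg_series_ffact_coef (R : realType) (p : {poly R}) (w : R) :
  series (fun n => (- w) ^+ n / n`!%:R * ffact_coef p n) n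
    @[n --> \oo] --> p.[w] * expR (- w).
Proof.
(* Changing the range affects only zero terms: the falling factorial vanishes for i > n, the
   coefficient of p for i >= size p. A range independent of n is needed to pass to the limit term by
   term. *)
have E n : ffact_coef p n = \sum_(i < size p) p`_i * ((-1) ^+ i * (n ^_ i)%:R).
  rewrite /ffact_coef.
  have -> : \sum_(i < n.+1) p`_i * (-1) ^+ i * (n ^_ i)%:R =
      \sum_(i < n.+1) p`_i * ((-1) ^+ i * (n ^_ i)%:R).
    by apply: eq_bigr => i _; rewrite mulrA.
  rewrite (big_ord_widen (maxn n.+1 (size p)) (fun i => p`_i * ((-1) ^+ i * (n ^_ i)%:R)))
    ?leq_maxl// [RHS](big_ord_widen (maxn n.+1 (size p))
    (fun i => p`_i * ((-1) ^+ i * (n ^_ i)%:R))) ?leq_maxr//.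
  rewrite big_mkcond [RHS]big_mkcond/=; apply: eq_bigr => i _.
  case: ifPn => ni; case: ifPn => pi //.
    by rewrite -leqNgt in pi; rewrite nth_default// mul0r.
  by rewrite ffact_small ?mulr0// ltnNge -ltnS.
rewrite horner_coef mulr_suml.
have : \sum_(i < size p) p`_i * series (fun n => (- w) ^+ n / n`!%:R *
      ((-1) ^+ i * (n ^_ i)%:R)) n @[n --> \oo] -->
    \sum_(i < size p) p`_i * (w ^+ i * expR (- w)).
  apply: cvg_big => [|i _]; first exact: add_continuous.
  by apply: cvgM; [exact: cvg_cst|exact: cvg_series_ffact].
under eq_bigr do rewrite mulrA.
apply: cvg_trans; apply: near_eq_cvg; apply: nearW => n.
rewrite /series/=; under eq_bigr do rewrite mulr_sumr.
rewrite exchange_big; apply: eq_bigr => j _.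
by rewrite E mulr_sumr; apply: eq_bigr => i _; ring.
Qed.

(** * Convergence of the power series *)

(** Dominated convergence for series. The tails of all the series are bounded by that of b, and the
    common head is a finite sum. *)
Lemma tannery (R : realType) (a : nat -> nat -> R) (b c : nat -> R) :
  (forall k n, `|a k n| <= b n) -> cvgn (series b) ->
  (forall n, a k n @[k --> \oo] --> c n) ->
  limn (series (a k)) @[k --> \oo] --> limn (series c).
Proof.
move=> ab cb ac.
have cab n : `|c n| <= b n.
  by apply: (ler_cvg_to (cvg_norm (ac n)) (cvg_cst (b n))); apply: nearW => k.
have dom (f : nat -> R) : (forall n, `|f n| <= b n) ->
    cvgn (series f) /\
    forall N, `|limn (series f) - series f N| <= limn (series b) - series b N.
  move=> fb.
  have nf : cvgn (series (fun n => `|f n|)).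
    by apply: series_le_cvg cb => // n; exact: le_trans (fb n).
  have cf : cvgn (series f) by exact: normed_cvg.
  split => // N.
  have h1 : `|series f n - series f N| @[n --> \oo] --> `|limn (series f) - series f N|.
    by apply: cvg_norm; apply: cvgB => //; exact: cvg_cst.
  have h2 : series b n - series b N @[n --> \oo] --> limn (series b) - series b N.
    by apply: cvgB => //; exact: cvg_cst.
  apply: (ler_cvg_to h1 h2); near=> n.
  have Nn : (N <= n)%N by near: n; exact: nbhs_infty_ge.
  rewrite !sub_series_geq//.
  by apply: (le_trans (ler_norm_sum _ _ _)); apply: ler_sum.
apply/cvgrPdist_le => e e0.
have e3 : 0 < e / 3 by rewrite divr_gt0.
have [N _ Nb] : \forall N \near \oo, limn (series b) - series b N <= e / 3.
  move/cvgrPdist_le : (cb) => /(_ _ e3); apply: filterS => n.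
  exact: le_trans (ler_norm _).
have : series (a k) N @[k --> \oo] --> series c N.
  by rewrite /series/=; apply: cvg_big => [|i _]; [exact: add_continuous|exact: ac].
move/cvgrPdist_le => /(_ _ e3) h.
near=> k.
have h1 := (dom c cab).2 N; have h2 := (dom (a k) (ab k)).2 N.
have h3 : `|series c N - series (a k) N| <= e / 3 by near: k.
have h4 := Nb N (leqnn N).
move: h1 h2 h3 h4; rewrite !ler_norml => /andP[? ?] /andP[? ?] /andP[? ?] ?.
by apply/andP; split; lra.
Unshelve. all: by end_near. Qed.

(** Handles the initial factors of Gauss's product: for i <= a, |1 - a/i| = a/i - 1 <= a/i. The
    bound is a term of the series of exp(a). *)
Lemma prod_le_expr_fact (R : realType) (a : R) (K : nat) : K%:R <= a ->
  \prod_(i < K) `|1 - a / i.+1%:R| <= a ^+ K / K`!%:R.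
Proof.
elim: K => [|K IH] Ka; first by rewrite big_ord0 expr0 fact0 divr1.
have K1a : K%:R <= a by rewrite (le_trans _ Ka)// ler_nat.
have a0 : 0 <= a by rewrite (le_trans _ K1a).
have K0 : 0 < K.+1%:R :> R by [].
rewrite big_ord_recr/= factS natrM exprSr invfM [(_^-1 * _)]mulrC mulrACA.
apply: ler_pM => //; [exact: prodr_ge0|exact: IH|].
rewrite ler0_norm ?opprB ?gerBl// subr_le0 ler_pdivlMr// mul1r//.
Qed.

(** With c = a/(n+1), the two factors are at most exp(c) and exp(-c). *)
Lemma gauss_factor_le1 (R : realType) (a : R) (n : nat) : 0 <= a <= n.+1%:R ->
  (n.+2%:R / n.+1%:R) `^ a * `|1 - a / n.+1%:R| <= 1.
Proof.
move=> /andP[a0 an].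
have n0 : 0 < n.+1%:R :> R by [].
rewrite ger0_norm; last by rewrite subr_ge0 ler_pdivrMr// mul1r.
have h1 : (n.+2%:R / n.+1%:R) `^ a <= expR (a / n.+1%:R).
  rewrite -[expR _]powRr1 ?expR_ge0// -expRM mulr1.
  rewrite /powR gt_eqF ?divr_gt0// ler_expR ler_wpM2l//.
  have -> : n.+2%:R / n.+1%:R = 1 + n.+1%:R^-1 :> R.
    by rewrite -[n.+2%:R]natr1; field; rewrite addrC natr1 pnatr_eq0.
  by rewrite le_ln1Dx// (@lt_trans _ _ 0) ?invr_gt0// ltrN10.
have h2 : 1 - a / n.+1%:R <= expR (- (a / n.+1%:R)) by exact: expR_ge1Dx.
rewrite -[leRHS](expRxMexpNx_1 (a / n.+1%:R)); apply: ler_pM => //.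
by rewrite subr_ge0 ler_pdivrMr// mul1r.
Qed.

Lemma gauss_recip_gammaE (R : realType) (a : R) (K : nat) :
  gauss_recip_gamma K (1 - a) = K.+1%:R `^ a * \prod_(i < K) (1 - a / i.+1%:R).
Proof.
rewrite /gauss_recip_gamma subKr -mulrA; congr (_ * _).
elim: K => [|K IH]; first by rewrite !big_ord0 fact0 divr1.
rewrite !big_ord_recr/= -IH factS natrM -natr1; field.
by rewrite natr1 !pnatr_eq0 -!lt0n fact_gt0.
Qed.

(* The factors [(1 + 1/i)^a * |1 - a/i|] with [i >= a] are at most 1. *)
Lemma gauss_recip_gamma_le (R : realType) (a : R) (K : nat) : 0 <= a ->
  `|gauss_recip_gamma K (1 - a)| <= expR a * (a + 1) `^ a.
Proof.
move=> a0; rewrite gauss_recip_gammaE normrM normr_prod (ger0_norm (powR_ge0 _ _)).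
have small k : k%:R <= a ->
    k.+1%:R `^ a * \prod_(i < k) `|1 - a / i.+1%:R| <= expR a * (a + 1) `^ a.
  move=> ka; rewrite mulrC; apply: ler_pM; rewrite ?powR_ge0 ?prodr_ge0//.
    apply: (le_trans (prod_le_expr_fact ka)); case: k ka => [|k] ka.
      by rewrite expr0 fact0 divr1 (le_trans _ (expR_ge1Dx a))// lerDl.
    by rewrite (le_trans _ (expR_ge1Dxn k a0))// lerDr.
  by rewrite ge0_ler_powR ?nnegrE ?addr_ge0// -natr1 lerD2r.
elim: K => [|K IH]; first exact: small.
have [Ka|aK] := leP K.+1%:R a; first exact: small.
apply: le_trans IH; rewrite big_ord_recr/=.
have -> : K.+2%:R = K.+1%:R * (K.+2%:R / K.+1%:R) :> R by rewrite mulrC divfK ?pnatr_eq0.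
rewrite powRM ?divr_ge0//.
have := gauss_factor_le1 (_ : 0 <= a <= K.+1%:R).
rewrite a0 (ltW aK) => /(_ isT)
  /(ler_wpM2l (_ : 0 <= K.+1%:R `^ a * \prod_(i < K) `|1 - a / i.+1%:R|)).
rewrite mulr1 mulr_ge0 ?powR_ge0 ?prodr_ge0// => /(_ isT); apply: le_trans.
by rewrite le_eqVlt; apply/orP; left; apply/eqP; ring.
Qed.

(** Geometric domination of the n-th term, uniform in K. With m = n+2, the bounds (a+1)^a <= m^a and
    n! >= m^n exp(-m) make the logarithm of the left side at most a linear function of n minus
    (1-beta) n ln m. The leading 4 is the sum of the constants in a <= n+1, beta * ln m <= n+1 and m
    = n+2; their three terms n, and one more that pays for the ratio exp(-1), give the 4 in 4 +
    x. *)
Lemma natS_powR_le (R : realType) (beta x a : R) (n : nat) : 0 < beta < 1 ->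
  0 <= x -> a = beta * n.+1%:R ->
  expR a * (a + 1) `^ a * x ^+ n / n`!%:R <=
  expR (4 + (1 - beta) * expR ((4 + x) / (1 - beta))) * expR (- 1) ^+ n.
Proof.
move=> /andP[b0 b1] x0 aE.
have n0 : 0 <= n%:R :> R by [].
set d := 1 - beta; have d0 : 0 < d by rewrite subr_gt0.
set m := (n.+2%:R : R); have m0 : 0 < m by [].
have a0 : 0 <= a by rewrite aE mulr_ge0// ltW.
have an : a <= n%:R + 1 by rewrite aE natr1 ler_piMl ?ltW.
have mE : m = n%:R + 2 by rewrite /m -addn2 natrD.
clearbody m.
have h1 : (a + 1) `^ a <= expR (a * ln m).
  rewrite (_ : expR (a * ln m) = m `^ a); last by rewrite /powR gt_eqF.
  rewrite ge0_ler_powR ?nnegrE ?addr_ge0 ?(ltW m0)// mE; lra.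
have h2 : x ^+ n <= expR (x * n%:R).
  by rewrite expRM_natr lerXn2r ?nnegrE ?expR_ge0// (le_trans _ (expR_ge1Dx x))// lerDr.
have h3 : n`!%:R^-1 <= expR (m - n%:R * ln m).
  have f0 : 0 < n`!%:R :> R by rewrite ltr0n fact_gt0.
  have : m ^+ n / n`!%:R <= expR m.
    case: (n) => [|k].
      by rewrite expr0 fact0 divr1 (le_trans _ (expR_ge1Dx m))// lerDl ltW.
    by rewrite (le_trans _ (expR_ge1Dxn k (ltW m0)))// lerDr.
  rewrite expRB expRM_natl lnK ?posrE// ler_pdivlMr ?exprn_gt0//.
  by rewrite mulrC.
have h4 : ln m <= n%:R + 1.
  by rewrite (_ : m = 1 + (n%:R + 1)) ?mE; [rewrite le_ln1Dx// | ]; lra.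
(* With L = (4+x)/d, the inequality 1 + u <= exp(u) at u = L - ln m gives L - ln m <= exp(L)/m, and
   n <= m. *)
have h5 : n%:R * ((4 + x) - d * ln m) <= d * expR ((4 + x) / d).
  have h : (4 + x) / d - ln m <= expR ((4 + x) / d) / m.
    have := expR_ge1Dx ((4 + x) / d - ln m); rewrite expRB lnK ?posrE//.
    by apply: le_trans; rewrite lerDr.
  have -> : n%:R * (4 + x - d * ln m) = d * (n%:R * ((4 + x) / d - ln m)).
    by field; rewrite gt_eqF.
  rewrite ler_wpM2l ?(ltW d0)//; apply: (le_trans (ler_wpM2l n0 h)).
  rewrite mulrCA ler_piMr ?expR_ge0// ler_pdivrMr// mul1r mE; lra.
have : expR a * (a + 1) `^ a * x ^+ n / n`!%:R <=
   expR a * expR (a * ln m) * expR (x * n%:R) * expR (m - n%:R * ln m).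
  apply: ler_pM => //; rewrite ?mulr_ge0 ?expR_ge0 ?powR_ge0 ?exprn_ge0//.
  apply: ler_pM => //; rewrite ?mulr_ge0 ?expR_ge0 ?powR_ge0 ?exprn_ge0//.
  by apply: ler_pM => //; rewrite ?mulr_ge0 ?expR_ge0 ?powR_ge0.
move=> /le_trans; apply; rewrite -expRM_natr -!expRD ler_expR.
have -> : a * ln m = (1 - d) * n%:R * ln m + beta * ln m by rewrite aE /d -natr1; ring.
have h6 : beta * ln m <= n%:R + 1.
  have lm0 : 0 <= ln m by rewrite ln_ge0// mE; lra.
  by rewrite (le_trans _ h4)// ler_piMl// ltW.
move: h5 h6 an mE; set l := ln m; set e := expR _; nra.
Qed.

(** * Convergence of the densities and of their integrals *)

Definition wright_dens (R : realType) (beta : R) (K : nat) (w : R) : R :=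
  (wright_poly beta K).[w] * expR (- w).

Definition wright_approx (R : realType) (beta : R) (K : nat) (r : R) : R :=
  K.+1%:R `^ beta * wright_dens beta K (K.+1%:R `^ beta * r).

Lemma wright_approx_lim (R : realType) (beta r : R) (K : nat) :
  wright_approx beta K r = limn (series (fun n =>
    (- r) ^+ n / n`!%:R * gauss_recip_gamma K (1 - beta * n.+1%:R))).
Proof.
apply/esym/cvg_lim => //.
set l := K.+1%:R `^ beta.
have : l * series (fun n => (- (l * r)) ^+ n / n`!%:R *
      ffact_coef (wright_poly beta K) n) n @[n --> \oo] -->
    wright_approx beta K r.
  by apply: cvgM; [exact: cvg_cst|exact: cvg_series_ffact_coef].
apply: cvg_trans; apply: near_eq_cvg; apply: nearW => n.
rewrite /series/= mulr_sumr; apply: eq_bigr => i _.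
rewrite ffact_coef_wright_poly gauss_recip_gammaE.
(* The Jacobian of the rescaling supplies the missing factor l, so the power is the one in
   [gauss_recip_gammaE]. *)
have -> : K.+1%:R `^ (beta * i.+1%:R) = l * l ^+ i.
  by rewrite powRrM powR_mulrn ?powR_ge0// exprS.
by rewrite -mulrN exprMn; ring.
Qed.

Lemma cvg_wright_approx (R : realType) (beta r : R) : 0 < beta < 1 -> 0 <= r ->
  wright_approx beta K r @[K --> \oo] --> M_Wright beta r.
Proof.
move=> b01 r0; have /andP[b0 b1] := b01.
under eq_fun do rewrite wright_approx_lim.
pose C := expR (4 + (1 - beta) * expR ((4 + r) / (1 - beta))).
apply: (@tannery R _ (fun n => C * expR (- 1) ^+ n)).
- move=> K n; rewrite normrM normrM normrX normrN (ger0_norm r0) normfV normr_nat.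
  have a0 : 0 <= beta * n.+1%:R by rewrite mulr_ge0// ltW.
  apply: le_trans (natS_powR_le b01 r0 erefl).
  rewrite [leRHS](_ : _ = r ^+ n / n`!%:R *
    (expR (beta * n.+1%:R) * (beta * n.+1%:R + 1) `^ (beta * n.+1%:R))); last by ring.
  rewrite ler_wpM2l ?gauss_recip_gamma_le//.
  by rewrite divr_ge0 ?exprn_ge0.
- apply: is_cvg_geometric_series.
  by rewrite ger0_norm ?expR_ge0// expR_lt1 ltrN10.
- move=> n; rewrite invfM mulrA; apply: cvgM; first exact: cvg_cst.
  apply: cvg_gauss_Gamma; rewrite gerBl mulr_ge0// ltW//.
Qed.

(** The recursion of [wright_poly], read on the densities; it makes explicit primitives possible. *)
Lemma is_derive_wright_dens (R : realType) (beta : R) (K : nat) (w : R) : beta != 0 ->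
  is_derive w 1 (fun w => w * wright_dens beta K w)
    (K.+1%:R / beta * (wright_dens beta K w - wright_dens beta K.+1 w)).
Proof.
move=> b0; rewrite /wright_dens.
rewrite (_ : (fun w => _) = (fun w => ('X * wright_poly beta K).[w] * expR (- w))); last first.
  by apply/funext => y; rewrite hornerM hornerX mulrA.
have h := is_derive_poly ('X * wright_poly beta K) w.
apply: trigger_derive; rewrite /GRing.scale /=.
rewrite !hornerE/=; field.
by rewrite b0 addrC natr1 pnatr_eq0.
Qed.

Lemma continuous_wright_dens (R : realType) (beta : R) (K : nat) :
  continuous (wright_dens beta K).
Proof.
move=> w; apply: cvgM; first exact: continuous_horner.
by apply: continuous_comp; [exact: opp_continuous|exact: continuous_expR].
Qed.

Lemma wright_dens_ge0 (R : realType) (beta w : R) (K : nat) :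
  0 <= beta <= 1 -> 0 <= w -> 0 <= wright_dens beta K w.
Proof. by move=> *; rewrite mulr_ge0 ?expR_ge0 ?horner_wright_poly_ge0. Qed.

Definition wright_prim (R : realType) (beta l : R) (v : R -> R) (K : nat) (r : R) : R :=
  - expR (- (l * r)) -
  \sum_(i < K) beta / i.+1%:R * (l * r * wright_dens beta i (l * r)) * v r ^+ i.+1.

(* The sum telescopes: the derivative of [w * q_i(w) * v^(i+1)], where
   [q_i := wright_dens beta i] and [w := l * r], is
   [l * (i+1) / beta * (q_i(w) * v^i - q_(i+1)(w) * v^(i+1))]. *)
Lemma is_derive_wright_prim (R : realType) (beta l : R) (v : R -> R) (K : nat) (r : R) :
  beta != 0 -> r != 0 -> is_derive r 1 v ((1 - v r) / (beta * r)) ->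
  is_derive r 1 (wright_prim beta l v K) (l * wright_dens beta K (l * r) * v r ^+ K).
Proof.
move=> b0 r0 dv; elim: K => [|K IH].
  rewrite (_ : wright_prim _ _ _ _ = (fun r => - expR (- (l * r)))); last first.
    by apply/funext => y; rewrite /wright_prim big_ord0 subr0.
  apply: trigger_derive; rewrite /GRing.scale /wright_dens /= hornerC expr0; ring.
pose g (y : R) := y * wright_dens beta K y.
have -> : wright_prim beta l v K.+1 =
    wright_prim beta l v K - (beta / K.+1%:R) \*: ((g \o ( *%R l)) * v ^+ K.+1).
  apply/funext => y; rewrite /wright_prim big_ord_recr/= opprD addrA.
  by rewrite !fctE; congr (_ - _); rewrite -mulrA.
have dg : is_derive (l * r) 1 g
  (K.+1%:R / beta * (wright_dens beta K (l * r) - wright_dens beta K.+1 (l * r))).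
  exact: is_derive_wright_dens.
have dl : is_derive r 1 ( *%R l) l by apply: trigger_derive; rewrite /GRing.scale/= mulr1.
have dgl := @is_derive1_comp _ _ _ _ _ _ dg dl.
have dX := @is_deriveX _ _ v K.+1 r 1 _ dv.
apply: is_derive_eq (is_deriveB IH (is_deriveZ _ (is_deriveM dgl dX))) _.
rewrite /GRing.scale /g ?exprfctE /= ?exprS; field.
by rewrite b0 r0 /= addrC natr1 pnatr_eq0.
Qed.

(** The weight is abstract because two solutions of beta * r * v' = 1 - v are used: the constant 1
    with a = 0, for the total mass, and 1 - (a/r)^(1/beta), for the kernel. The condition a * v(a) =
    0 covers both and removes every boundary term at a except the exponential. *)
Lemma integral_wright_dens (R : realType) (beta l a : R) (v : R -> R) (K : nat) :
  0 < beta <= 1 -> 0 < l -> 0 <= a -> (forall r, a <= r -> 0 <= v r <= 1) ->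
  (forall r, a < r -> is_derive r 1 v ((1 - v r) / (beta * r))) ->
  v r @[r --> a^'+] --> v a -> a * v a = 0 ->
  (\int[lebesgue_measure]_(r in `[a, +oo[)
     (l * wright_dens beta K (l * r) * v r ^+ K)%:E = (expR (- (l * a)))%:E)%E.
Proof.
move=> /andP[b0 b1] l0 a0 v01 dv va ava.
have dF (r : R) : a < r ->
    is_derive r 1 (wright_prim beta l v K) (l * wright_dens beta K (l * r) * v r ^+ K).
  move=> ar; apply: is_derive_wright_prim; first by rewrite gt_eqF.
    by rewrite gt_eqF// (le_lt_trans a0).
  exact: dv.
have vX (F : set_system R) (y : R) n : Filter F ->
    v r @[r --> F] --> y -> v r ^+ n @[r --> F] --> y ^+ n.
  by move=> FF h; exact: (cvg_comp _ _ h (@exprn_continuous R n y)).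
have b01 : 0 <= beta <= 1 by rewrite (ltW b0).
have cq (i : nat) : continuous (fun r : R => wright_dens beta i (l * r)).
  move=> r; apply: continuous_comp; first exact: mulrl_continuous.
  exact: continuous_wright_dens.
have ce : continuous (fun r : R => expR (- (l * r))).
  move=> r; apply: continuous_comp; last exact: continuous_expR.
  by apply: continuous_comp; [exact: mulrl_continuous|exact: opp_continuous].
have Fa : wright_prim beta l v K a = - expR (- (l * a)).
  rewrite /wright_prim big1 ?subr0// => i _.
  rewrite exprS; transitivity (beta / i.+1%:R * l * wright_dens beta i (l * a) * (a * v a)
    * v a ^+ i); first by ring.
  by rewrite ava mulr0 mul0r.
rewrite (@ge0_continuous_FTC2y _ _ (wright_prim beta l v K) a 0).
- by rewrite Fa -EFinB sub0r opprK.
- move=> r ar; have /andP[v0 _] := v01 _ ar.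
  rewrite mulr_ge0 ?exprn_ge0// mulr_ge0 ?(ltW l0)// wright_dens_ge0//.
  by rewrite mulr_ge0 ?(ltW l0)// (le_trans a0).
- apply/continuous_within_itvcyP; split.
    move=> r; rewrite in_itv/= andbT => ar; apply: cvgM.
      by apply: cvgM; [exact: cvg_cst|exact: cq].
    apply: vX; apply: differentiable_continuous; apply/derivable1_diffP.
    by have h := dv _ ar; exact: ex_derive.
  apply: cvgM; last exact: vX.
  by apply: cvg_at_right_filter; apply: cvgM; [exact: cvg_cst|exact: cq].
- have lry : l * r @[r --> +oo] --> +oo by exact: gt0_cvgMry.
  have E0 : expR (- (l * r)) @[r --> +oo] --> (0 : R).
    exact: (cvg_comp _ _ lry (@cvgr_expR R)).
  have T0 (i : nat) : l * r * wright_dens beta i (l * r) * v r ^+ i.+1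
      @[r --> +oo] --> (0 : R).
    have h : l * r * wright_dens beta i (l * r) @[r --> +oo] --> (0 : R).
      have := cvg_comp _ _ lry (@cvgy_horner_expRN R ('X * wright_poly beta i)).
      apply: cvg_trans; apply: near_eq_cvg; apply: nearW => r.
      by rewrite /= hornerM hornerX mulrA.
    apply: (squeeze_cvgr _ (@cvg_cst _ (0 : R) _ _ _) h); near=> r.
    have ar : a <= r by near: r; apply: nbhs_pinfty_ge; exact: num_real.
    have /andP[v0 v1] := v01 _ ar.
    have t0 : 0 <= l * r * wright_dens beta i (l * r).
      have lr0 : 0 <= l * r by rewrite mulr_ge0 ?(ltW l0)// (le_trans a0).
      by rewrite mulr_ge0// wright_dens_ge0.
    by rewrite mulr_ge0 ?exprn_ge0//= ler_piMr// exprn_ile1.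
  have : - expR (- (l * r)) - \sum_(i < K) beta / i.+1%:R *
      (l * r * wright_dens beta i (l * r) * v r ^+ i.+1) @[r --> +oo] -->
      - 0 - \sum_(i < K) beta / i.+1%:R * (0 : R).
    apply: cvgB; first exact: cvgN.
    apply: cvg_big => [|i _]; first exact: add_continuous.
    by apply: cvgM; [exact: cvg_cst|exact: T0].
  rewrite big1 ?oppr0 ?addr0; last by move=> i _; rewrite mulr0.
  apply: cvg_trans; apply: near_eq_cvg; apply: nearW => r.
  by rewrite /wright_prim; congr (_ - _); apply: eq_bigr => i _; rewrite !mulrA.
- by move=> r /dF h; exact: ex_derive.
- rewrite /wright_prim; apply: cvgB.
    by apply: cvgN; apply: cvg_at_right_filter; exact: ce.
  apply: cvg_big => [|i _]; first exact: add_continuous.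
  apply: cvgM; last exact: vX.
  apply: cvg_at_right_filter; apply: cvgM; first exact: cvg_cst.
  by apply: cvgM; [exact: mulrl_continuous|exact: cq].
- move=> r; rewrite in_itv/= andbT => /dF h.
  by rewrite derive1E derive_val.
Unshelve. all: by end_near. Qed.

Lemma cvg_posC_expn (R : realType) (c : R) :
  Num.max 0 (1 - c / n.+2%:R) ^+ n.+1 @[n --> \oo] --> expR (- c).
Proof.
have lim (z : R) : expR (- (c * (n.+1%:R / (n%:R + z)))) @[n --> \oo] --> expR (- c).
  apply: continuous_cvg; first exact: continuous_expR.
  apply: cvgN; rewrite -[c in X in _ --> X]mulr1.
  by apply: cvgM; [exact: cvg_cst|exact: cvg_natS_ratio].
(* For n > c, put u = c/(n+2) < 1. Then exp(-u/(1-u)) <= 1 - u <= exp(-u), where u/(1-u) =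
   c/(n+2-c). *)
apply: (squeeze_cvgr _ (lim (2 - c)) (lim 2)); near=> n.
have cn : c < n%:R by near: n; exact: nbhs_infty_gtr.
have nE : n.+2%:R = n%:R + 2 :> R by rewrite -addn2 natrD.
have n0 : 0 < n%:R + 2 :> R by rewrite ltr_wpDl.
have n1 : 0 < n%:R + 2 - c by rewrite subr_gt0 (lt_trans cn)// ltrDl.
have y0 : 0 < 1 - c / (n%:R + 2) by rewrite subr_gt0 ltr_pdivrMr// mul1r -subr_gt0.
rewrite nE; apply/andP; split.
  have -> : - (c * (n.+1%:R / (n%:R + (2 - c)))) = n.+1%:R * (- (c / (n%:R + 2 - c))).
    by rewrite addrA; ring.
  rewrite expRM_natl lerXn2r ?nnegrE ?expR_ge0 ?le_max ?lexx//.
  apply/orP; right; rewrite expRN -[leRHS]invrK lef_pV2 ?posrE ?expR_gt0 ?invr_gt0//.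
  apply: le_trans (expR_ge1Dx _).
  by rewrite le_eqVlt; apply/orP; left; apply/eqP; field; rewrite !gt_eqF.
have -> : - (c * (n.+1%:R / (n%:R + 2))) = n.+1%:R * (- (c / (n%:R + 2))) by ring.
rewrite expRM_natl lerXn2r ?nnegrE ?expR_ge0 ?le_max ?lexx//.
by rewrite ge_max expR_ge0/= expR_ge1Dx.
Unshelve. all: by end_near. Qed.

Lemma continuous_wright_approx (R : realType) (beta : R) (K : nat) :
  continuous (wright_approx beta K).
Proof.
move=> r; apply: cvgM; first exact: cvg_cst.
apply: continuous_comp; first exact: mulrl_continuous.
exact: continuous_wright_dens.
Qed.

Lemma measurable_wright_approx (R : realType) (beta : R) (K : nat) (D : set R) :
  measurable_fun D (wright_approx beta K).
Proof.
apply: measurable_funTS; apply: continuous_measurable_fun.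
exact: continuous_wright_approx.
Qed.

Lemma wright_approx_ge0 (R : realType) (beta r : R) (K : nat) :
  0 <= beta <= 1 -> 0 <= r -> 0 <= wright_approx beta K r.
Proof.
move=> b r0; rewrite mulr_ge0 ?powR_ge0// wright_dens_ge0//.
by rewrite mulr_ge0 ?powR_ge0.
Qed.

Lemma integral_wright_approx (R : realType) (beta : R) (K : nat) : 0 < beta <= 1 ->
  (\int[lebesgue_measure]_(r in `]0%R, +oo[) (wright_approx beta K r)%:E = 1)%E.
Proof.
move=> b01; have l0 : 0 < K.+1%:R `^ beta :> R by rewrite powR_gt0.
transitivity (\int[lebesgue_measure]_(r in `[0%R, +oo[)
    (K.+1%:R `^ beta * wright_dens beta K (K.+1%:R `^ beta * r) * 1 ^+ K)%:E)%E.
  rewrite integral_itv_obnd_cbnd; last first.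
    apply/measurable_EFinP; exact: measurable_wright_approx.
  by apply: eq_integral => r _; rewrite expr1n mulr1.
have v01 (r : R) : 0 <= r -> 0 <= (fun=> 1 : R) r <= 1 by rewrite ler01 lexx.
have dv (r : R) : 0 < r -> is_derive r 1 (fun=> 1 : R) ((1 - 1) / (beta * r)).
  by move=> _; rewrite subrr mul0r; exact: is_derive_cst.
rewrite (integral_wright_dens K b01 l0 (lexx _) v01 dv) ?mul0r//.
  by rewrite mulr0 oppr0 expR0.
exact: cvg_cst.
Qed.

Lemma is_derive_ratio_powR (R : realType) (a p r : R) : 0 < a -> 0 < r ->
  is_derive r 1 (fun r => 1 - (a / r) `^ p) (p * (a / r) `^ p / r).
Proof.
move=> a0 r0.
have ar : 0 < a / r by rewrite divr_gt0.
have r0' : r != 0 by rewrite gt_eqF.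
have dV : is_derive r 1 (fun r => a / r) (- a / r ^+ 2).
  have := @is_deriveV R id r 1 1 r0' (is_derive_id _ _) => dVr.
  by apply: trigger_derive; rewrite /GRing.scale /=; field.
have dp := is_derive1_powR p ar.
have dc := @is_derive1_comp _ (fun y : R => y `^ p) (fun r => a / r) r _ _ dp dV.
apply: trigger_derive; rewrite /GRing.scale /=.
have -> : (a / r) `^ p = (a / r) * (a / r) `^ (p - 1).
  have : (a / r) `^ (1 + (p - 1)) = (a / r) `^ 1 * (a / r) `^ (p - 1).
    by rewrite [LHS]powRD// (lt0r_neq0 ar) implybT.
  by rewrite subrKC powRr1 ?(ltW ar).
by field.
Qed.

Lemma measurable_ratio_powR (R : realType) (c p : R) (D : set R) :
  measurable_fun D (fun r => (c / r) `^ p).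
Proof.
(* The inverse of r is r times the power -1 of the nonnegative number r^2, a form covered by
   [measurable_powR]; at r = 0 both are 0. *)
have -> : (fun r : R => (c / r) `^ p) = (fun r => (c * (r * (r ^+ 2) `^ (-1))) `^ p).
  apply/funext => r; rewrite powR_inv1 ?sqr_ge0// expr2 invfM.
  by have [->|r0] := eqVneq r 0; [rewrite invr0 !mul0r|rewrite mulVKf].
apply: (measurableT_comp (measurable_powR _)); apply: measurable_funTS.
do 2 apply: measurable_funM => //.
by apply: (measurableT_comp (measurable_powR _)).
Qed.

(** The positive part extends the integral from [x/(K+1)^beta, +oo[ to a half-line independent of K,
    on which Fatou's lemma can be applied. *)
Definition wright_kernel (R : realType) (beta x : R) (K : nat) (r : R) : R :=
  Num.max 0 (1 - (x / K.+1%:R `^ beta / r) `^ beta^-1) ^+ K.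

Lemma integral_wright_approx_kernel (R : realType) (beta x : R) (K : nat) :
  0 < beta <= 1 -> 0 < x -> (0 < K)%N ->
  (\int[lebesgue_measure]_(r in `]0%R, +oo[)
    (wright_approx beta K r * wright_kernel beta x K r)%:E = (expR (- x))%:E)%E.
Proof.
move=> b01 x0 K0; have /andP[b0 b1] := b01.
set l := K.+1%:R `^ beta; have l0 : 0 < l by rewrite powR_gt0.
set a := x / l; have a0 : 0 < a by rewrite divr_gt0.
pose v (r : R) := 1 - (a / r) `^ beta^-1.
have bV0 : 0 <= beta^-1 by rewrite invr_ge0 ltW.
have p1 : 1 `^ beta^-1 = 1 :> R by rewrite powR1.
have v01 r : a <= r -> 0 <= v r <= 1.
  move=> ar; have r0 := lt_le_trans a0 ar.
  rewrite gerBl powR_ge0 andbT subr_ge0 -[leRHS]p1.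
  have ar0 : 0 <= a / r by exact: divr_ge0 (ltW a0) (ltW r0).
  rewrite ge0_ler_powR ?nnegrE ?ar0//.
  by rewrite ler_pdivrMr// mul1r.
have va : v a = 0 by rewrite /v divff ?gt_eqF// powR1 subrr.
have dv r : a < r -> is_derive r 1 v ((1 - v r) / (beta * r)).
  move=> ar; have r0 := lt_trans a0 ar.
  apply: is_derive_eq (is_derive_ratio_powR _ a0 r0) _.
  by rewrite /v; field; rewrite !gt_eqF.
have E := @integral_wright_dens R beta l a v K b01 l0 (ltW a0) v01 dv.
have xE : l * a = x by rewrite /a mulrC divfK ?gt_eqF.
rewrite xE in E; rewrite -E; last 2 first.
  apply: cvg_at_right_filter; apply: differentiable_continuous.
  apply/derivable1_diffP; have h := is_derive_ratio_powR beta^-1 a0 a0.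
  exact: ex_derive.
  by rewrite va mulr0.
have fa (r : R) : 0 < r -> r < a -> wright_approx beta K r * wright_kernel beta x K r = 0.
  move=> r0 ra; rewrite /wright_kernel -/l -/a (max_idPl _) ?expr0n ?gtn_eqF ?mulr0//.
  rewrite subr_le0 -[leLHS]p1.
  have ar0 : 0 <= a / r by exact: divr_ge0 (ltW a0) (ltW r0).
  rewrite ge0_ler_powR ?nnegrE ?ar0//.
  by rewrite ler_pdivlMr// mul1r ltW.
rewrite integral_mkcond [RHS]integral_mkcond/=; apply: eq_integral => r _.
rewrite !patchE !mem_setE !in_itv/= !andbT.
have [r0|r0] := ltP 0 r; last by rewrite leNgt (le_lt_trans r0 a0).
have [ar|ra] := leP a r; last by rewrite /= (fa r r0 ra).
rewrite /wright_approx /wright_kernel -/l -/a (max_idPr _)//.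
by have /andP[] := v01 _ ar.
Qed.

Lemma integral_M_Wright_expR (R : realType) (beta x : R) : 0 < beta < 1 -> 0 < x ->
  measurable_fun (`[0, +oo[ : set R) (M_Wright beta) ->
  (forall t, 0 <= t -> 0 <= M_Wright beta t) ->
  (\int[lebesgue_measure]_(t in `[0%R, +oo[) (M_Wright beta t)%:E = 1)%E ->
  (\int[lebesgue_measure]_(t in `]0%R, +oo[)
    (M_Wright beta t * expR (- (x / t) `^ beta^-1))%:E = (expR (- x))%:E)%E.
Proof.
move=> b01 x0 mM M0 M1; have /andP[b0 b1] := b01.
have b01' : 0 < beta <= 1 by rewrite b0 ltW.
have b01'' : 0 <= beta <= 1 by rewrite !ltW.
pose D : set R := `]0, +oo[%classic.
pose q n r := wright_approx beta n.+1 r.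
pose h n r := wright_kernel beta x n.+1 r.
pose e r := expR (- (x / r) `^ beta^-1).
have mD : measurable D by exact: measurable_itv.
have h01 n r : 0 <= h n r <= 1.
  rewrite /h /wright_kernel exprn_ge0 ?le_max ?lexx//= exprn_ile1 ?le_max ?lexx//.
  by rewrite ge_max ler01/= gerBl powR_ge0.
have e01 r : 0 <= e r <= 1.
  by rewrite /e expR_ge0 expR_le1 oppr_le0 powR_ge0.
have q0 n r : D r -> 0 <= q n r.
  by rewrite /D/= in_itv/= andbT => r0; rewrite wright_approx_ge0// ltW.
have M0' r : D r -> 0 <= M_Wright beta r.
  by rewrite /D/= in_itv/= andbT => r0; rewrite M0// ltW.
have mh n : measurable_fun D (h n).
  rewrite /h /wright_kernel; apply: measurable_funX; apply: measurable_maxr => //.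
  by apply: measurable_funB => //; apply: measurable_ratio_powR.
have me : measurable_fun D e.
  apply: measurableT_comp => //.
  by apply: measurableT_comp => //; exact: measurable_ratio_powR.
have mq n : measurable_fun D (q n) by exact: measurable_wright_approx.
have mM' : measurable_fun D (M_Wright beta).
  by apply: measurable_funS mM => //; apply: subset_itvr; rewrite bnd_simp.
have lq r : D r -> q n r @[n --> \oo] --> M_Wright beta r.
  rewrite /D/= in_itv/= andbT => r0.
  have := cvg_wright_approx b01 (ltW r0); rewrite -cvg_shiftS; exact.
have lh r : D r -> h n r @[n --> \oo] --> e r.
  rewrite /D/= in_itv/= andbT => r0.
  have := @cvg_posC_expn R ((x / r) `^ beta^-1); apply: cvg_trans.
  apply: near_eq_cvg; apply: nearW => n.
  rewrite /h /wright_kernel; congr (Num.max _ (_ - _) ^+ _).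
  (* The scale leaves the power as l^(1/beta) = n+2, so the kernel is the positive part of 1 -
     c/(n+2), raised to n+1, with c = (x/r)^(1/beta). *)
  set l := n.+2%:R `^ beta; have l0 : 0 < l by rewrite powR_gt0.
  have nE : n.+2%:R = l `^ beta^-1 :> R.
    by rewrite -powRrM divff ?gt_eqF// powRr1.
  have kE : (x / r) `^ beta^-1 = (x / l / r) `^ beta^-1 * l `^ beta^-1.
    have xlr : 0 <= x / l / r by rewrite ltW// !divr_gt0.
    by rewrite -powRM ?xlr ?(ltW l0)//; congr (_ `^ _); field; rewrite !gt_eqF.
  by rewrite nE kE mulfK// gt_eqF// powR_gt0.
have Iq n : (\int[lebesgue_measure]_(r in D) (q n r)%:E = 1)%E.
  exact: integral_wright_approx.
have Iqh n : (\int[lebesgue_measure]_(r in D) (q n r * h n r)%:E = (expR (- x))%:E)%E.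
  exact: integral_wright_approx_kernel.
have split_int (f g : R -> R) : measurable_fun D f -> measurable_fun D g ->
    (forall r, D r -> 0 <= f r) -> (forall r, 0 <= g r <= 1) ->
    (\int[lebesgue_measure]_(r in D) (f r)%:E =
     \int[lebesgue_measure]_(r in D) (f r * g r)%:E +
     \int[lebesgue_measure]_(r in D) (f r * (1 - g r))%:E)%E.
  move=> mf mg f0 g01; rewrite -ge0_integralD//.
  - by apply: eq_integral => r _; rewrite -EFinD; congr EFin; ring.
  - by move=> r /f0 fr0; rewrite lee_fin mulr_ge0//; have /andP[] := g01 r.
  - by apply/measurable_EFinP; apply: measurable_funM.
  - by move=> r /f0 fr0; rewrite lee_fin mulr_ge0// subr_ge0; have /andP[] := g01 r.
  - by apply/measurable_EFinP; apply: measurable_funM => //; apply: measurable_funB.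
have IqC n : (\int[lebesgue_measure]_(r in D) (q n r * (1 - h n r))%:E =
    (1 - expR (- x))%:E)%E.
  have := split_int (q n) (h n) (mq n) (mh n) (q0 n) (h01 n).
  rewrite Iq Iqh => E; rewrite EFinB E addeAC subee// add0e//.
have fatou_le (g : nat -> R -> R) (c : R) (f : R -> R) :
    (forall n, measurable_fun D (g n)) -> (forall n r, D r -> 0 <= g n r) ->
    (forall r, D r -> g n r @[n --> \oo] --> f r) ->
    (forall n, \int[lebesgue_measure]_(r in D) (g n r)%:E = c%:E)%E ->
    (\int[lebesgue_measure]_(r in D) (f r)%:E <= c%:E)%E.
  move=> mg g0 gf gc.
  have := @fatou _ _ R lebesgue_measure D mD (fun n r => (g n r)%:E).
  have -> : limn_einf (fun n => \int[lebesgue_measure]_(r in D) (g n r)%:E)%E = c%:E.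
    under eq_fun do rewrite gc.
    have cc : (fun=> c%:E) n @[n --> \oo] --> c%:E by exact: cvg_cst.
    by rewrite is_cvg_limn_einfE; [exact/cvg_lim|apply/cvg_ex; exists c%:E].
  have -> : (\int[lebesgue_measure]_(r in D) limn_einf (fun n => (g n r)%:E) =
      \int[lebesgue_measure]_(r in D) (f r)%:E)%E.
    apply: eq_integral => r; rewrite inE => Dr.
    have fr : (g n r)%:E @[n --> \oo] --> (f r)%:E.
      by apply: cvg_EFin; [exact: nearW|exact: gf].
    by rewrite is_cvg_limn_einfE; [exact/cvg_lim|apply/cvg_ex; exists (f r)%:E].
  apply.
    by move=> n; apply/measurable_EFinP; exact: mg.
  by move=> n r Dr; rewrite lee_fin g0.
have M1' : (\int[lebesgue_measure]_(r in D) (M_Wright beta r)%:E = 1)%E.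
  rewrite -M1 integral_itv_obnd_cbnd//; apply/measurable_EFinP; exact: mM'.
have A : (\int[lebesgue_measure]_(r in D) (M_Wright beta r * e r)%:E <= (expR (- x))%:E)%E.
  apply: (fatou_le (fun n r => q n r * h n r)) => //.
  - by move=> n; exact: measurable_funM.
  - by move=> n r Dr; rewrite mulr_ge0 ?q0//; have /andP[] := h01 n r.
  - by move=> r Dr; apply: cvgM; [exact: lq|exact: lh].
have B : (\int[lebesgue_measure]_(r in D) (M_Wright beta r * (1 - e r))%:E <=
    (1 - expR (- x))%:E)%E.
  apply: (fatou_le (fun n r => q n r * (1 - h n r))) => //.
  - by move=> n; apply: measurable_funM => //; apply: measurable_funB.
  - by move=> n r Dr; rewrite mulr_ge0 ?q0// subr_ge0; have /andP[] := h01 n r.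
  - move=> r Dr; apply: cvgM; first exact: lq.
    by apply: cvgB; [exact: cvg_cst|exact: lh].
(* Fatou only bounds the two limit integrals from above, by exp(-x) and 1 - exp(-x). Their sum is
   the mass 1 of [M_Wright], so neither bound can be strict. *)
have := split_int _ _ mM' me M0' e01; rewrite M1'.
move: A B; set I1 := (\int[lebesgue_measure]_(r in D) (M_Wright beta r * e r)%:E)%E.
set I2 := (\int[lebesgue_measure]_(r in D) (M_Wright beta r * (1 - e r))%:E)%E.
move=> A B S; apply/eqP; rewrite eq_le A/=.
have I10 : (0 <= I1)%E.
  apply: integral_ge0 => r Dr; rewrite lee_fin mulr_ge0 ?M0'//.
  by have /andP[] := e01 r.
have I20 : (0 <= I2)%E.
  apply: integral_ge0 => r Dr; rewrite lee_fin mulr_ge0 ?M0'// subr_ge0.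
  by have /andP[] := e01 r.
move: A B S I10 I20; case: I1 => [i1||]; case: I2 => [i2||]//=.
rewrite -EFinD !lee_fin => _ B [S] _ _.
by rewrite -(lerD2r i2) -S; move: B; lra.
Qed.

(** * Laws on the half-line *)

Import HBNNSimple.

(** [has_density] speaks of sets only; the formula extends to functions through simple functions and
    monotone convergence. *)
Lemma ge0_integral_has_density (R : realType) (d : measure_display)
    (T : measurableType d) (P : probability T R) (X : {RV P >-> R}) (f g : R -> R) :
  has_density X f -> measurable_fun setT g -> (forall x, 0 <= g x) ->
  (\int[distribution P X]_x (g x)%:E =
   \int[lebesgue_measure]_(x in `[0%R, +oo[) (g x * f x)%:E)%E.
Proof.
move=> [mf f0 dX] mg g0.
pose D : set R := `[0, +oo[%classic.
have mD : measurable D by exact: measurable_itv.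
have mg' : measurable_fun setT (EFin \o g) by exact/measurable_EFinP.
pose h := nnsfun_approx measurableT mg'.
have mh n : measurable_fun setT (h n) by exact: measurable_funP.
have hnd x m n : (m <= n)%N -> h m x <= h n x.
  by move=> mn; exact/lefP/nd_nnsfun_approx.
have hg x : (h n x)%:E @[n --> \oo] --> (g x)%:E.
  by apply: (@cvg_nnsfun_approx _ _ _ _ measurableT _ mg') => // y _; rewrite lee_fin.
have Df0 x : D x -> 0 <= f x by rewrite /D/= in_itv/= andbT; exact: f0.
have mfE : measurable_fun D (EFin \o f) by exact/measurable_EFinP.
transitivity (limn (fun n => \int[distribution P X]_x (h n x)%:E)%E).
  rewrite -monotone_convergence//.
  - by apply: eq_integral => x _; apply/esym/cvg_lim.
  - by move=> n; exact/measurable_EFinP/measurable_funP.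
  - by move=> n x _; rewrite lee_fin.
  - by move=> x _ m n mn; rewrite lee_fin; exact/lefP/nd_nnsfun_approx.
transitivity (limn (fun n => \int[lebesgue_measure]_(x in D) (h n x * f x)%:E)%E); last first.
  rewrite -monotone_convergence//.
  - apply: eq_integral => x; rewrite inE => Dx; apply/cvg_lim => //.
    under eq_fun do rewrite EFinM.
    by rewrite EFinM; apply: cvgeZr.
  - move=> n; apply/measurable_EFinP; apply: measurable_funM => //.
    exact: measurable_funTS (mh n).
  - by move=> n x Dx; rewrite lee_fin mulr_ge0 ?Df0.
  - move=> x Dx m n mn; rewrite lee_fin ler_wpM2r ?Df0//.
    exact: hnd.
congr (limn _); apply/funext => n.
transitivity (\int[distribution P X]_x
   (\sum_(y \in range (h n)) (y * \1_(h n @^-1` [set y]) x)%:E))%E.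
  by apply: eq_integral => t _; rewrite /= fimfunE -fsumEFin.
have indich m r : measurable_fun setT (fun x => (r * \1_(h m @^-1` [set r]) x)%:E).
  by apply: (measurable_comp measurableT) => //; exact: measurable_funM.
rewrite ge0_integral_fsum//; last by move=> m y Ey; exact: nnfun_muleindic_ge0.
transitivity (\int[lebesgue_measure]_(x in D) (\sum_(y \in range (h n))
    ((y * \1_(h n @^-1` [set y]) x)%:E * (f x)%:E)))%E; last first.
  apply: eq_integral => x; rewrite inE => Dx.
  rewrite -ge0_mule_fsuml => [|y]; last exact: nnfun_muleindic_ge0.
  by rewrite fsumEFin// EFinM; congr (_%:E * _)%E; exact: esym (fimfunE (h n) x).
rewrite ge0_integral_fsum//; last 2 first.
  - by move=> y; apply: emeasurable_funM; [exact: measurable_funTS (indich _ _)|exact: mfE].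
  - move=> m y Ey; apply: mule_ge0; first exact: nnfun_muleindic_ge0.
    by rewrite lee_fin Df0.
apply: eq_fsbigr => r rhn.
have r0 : 0 <= r by move: rhn; rewrite inE => -[t _ <-].
have mA : measurable (h n @^-1` [set r]).
  by rewrite -[X in measurable X]setTI; exact: mh.
have mI : measurable_fun setT (fun x : R => (\1_(h n @^-1` [set r]) x)%:E : \bar R).
  by apply/measurable_EFinP; exact: measurable_indic.
under eq_integral do rewrite EFinM.
rewrite ge0_integralZl_EFin//.
rewrite integral_indic// setIT.
transitivity (r%:E * \int[lebesgue_measure]_(x in (h n @^-1` [set r]) `&` D) (f x)%:E)%E.
  by congr (_ * _)%E; exact: dX.
under [RHS]eq_integral do rewrite EFinM -muleA.
rewrite ge0_integralZl_EFin//; last 2 first.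
  by move=> x Dx; rewrite mule_ge0 ?lee_fin ?Df0.
  by apply: emeasurable_funM; [exact: measurable_funTS mI|exact: mfE].
congr (_ * _)%E; rewrite setIC integral_mkcondr.
apply: eq_integral => x Dx; rewrite patchE indicE; case: ifPn => xA.
  by rewrite mul1e.
by rewrite mul0e.
Qed.

(** The open rays form a generating class stable under intersection, and those starting at x <= 0
    have mass 1 under both laws. *)
Lemma probability_eq_gt (R : realType) (m1 m2 : probability R R) :
  m1 `]0, +oo[%classic = 1%E -> m2 `]0, +oo[%classic = 1%E ->
  (forall x, 0 < x -> m1 `]x, +oo[%classic = m2 `]x, +oo[%classic) ->
  forall A, measurable A -> m1 A = m2 A.
Proof.
move=> m11 m21 m12.
have full (m : probability R R) (x : R) : m `]0, +oo[%classic = 1%E -> x <= 0 ->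
    m `]x, +oo[%classic = 1%E.
  move=> m1E x0; apply/eqP; rewrite eq_le probability_le1//= -m1E.
  apply: le_measure; rewrite ?inE//.
  by apply: subset_itvr; rewrite bnd_simp.
apply: (measure_unique (@RGenOInfty.G R) (fun n => `](- n%:R), +oo[%classic)).
- exact: RGenOInfty.measurableE.
- move=> _ _ [x ->] [y ->]; exists (Num.max x y).
  by apply/seteqP; split => z /=; rewrite !in_itv/= !andbT gt_max => /andP.
- by move=> i; exists (- i%:R).
- apply/seteqP; split => // x _; exists (Num.truncn `|x|).+1 => //=.
  rewrite in_itv/= andbT ltrNl; apply: le_lt_trans (truncnS_gt _).
  by rewrite -normrN ler_norm.
- move=> _ [x ->]; have [x0|x0] := ltP 0 x; first exact: m12.
  by transitivity (1%E : \bar R); [exact: full|apply/esym; exact: full].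
- by move=> k; rewrite (le_lt_trans (probability_le1 _ _))// ltry.
Qed.

Lemma distribution_expR_gt (R : realType) (d : measure_display)
    (T : measurableType d) (P : probability T R) (X : {RV P >-> R}) (x : R) :
  has_density X (fun x => expR (- x)) -> 0 <= x ->
  distribution P X `]x, +oo[%classic = (expR (- x))%:E.
Proof.
move=> [_ _ dX] x0; rewrite dX//.
rewrite (_ : _ `&` _ = `]x, +oo[%classic); last first.
  apply/seteqP; split => y /=; rewrite !in_itv/= !andbT; first by move=> [].
  by move=> xy; split => //; rewrite (le_trans x0)// ltW.
rewrite integral_itv_obnd_cbnd; last first.
  apply/measurable_EFinP; apply: measurable_funTS.
  by apply: measurableT_comp.
have ce : continuous (fun y : R => expR (- y)).
  by move=> y; apply: continuous_comp; [exact: opp_continuous|exact: continuous_expR].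
rewrite (@ge0_continuous_FTC2y _ _ (fun y => - expR (- y)) x 0)//.
- by rewrite EFinN sub0e oppeK.
- exact: continuous_subspaceT.
- by rewrite -oppr0; apply: cvgN; exact: cvgr_expR.
- by apply/cvg_at_right_filter; apply: cvgN; exact: ce.
- move=> y _; rewrite derive1E; apply: (@derive_val _ _ _ _ _ _ _ _).
  by apply: trigger_derive; rewrite /GRing.scale /=; ring.
Qed.

(** * Invariant laws of the map (y, t) -> y^beta * t *)

Section fixed_point.
Context {R : realType}.
Implicit Types (m mu kappa : probability R R) (beta : R).

Let pos : set R := `]0, +oo[%classic.

Let measurable_pos : measurable pos. Proof. exact: measurable_itv. Qed.

(** The point 0 is Lebesgue-null. Positivity almost surely is what allows taking logarithms. *)
Lemma has_density_gt0 (d : measure_display) (T : measurableType d)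
    (P : probability T R) (X : {RV P >-> R}) (f : R -> R) :
  has_density X f -> distribution P X pos = 1%E.
Proof.
move=> [mf f0 dX]; rewrite -(probability_setT (distribution P X)) [RHS]dX// dX//.
rewrite setTI (_ : pos `&` _ = pos); last first.
  apply/seteqP; split => x /=; rewrite /pos/= !in_itv/= !andbT; first by case.
  by move=> x0; split => //; exact: ltW.
rewrite integral_itv_obnd_cbnd//; apply/measurable_EFinP.
by apply: measurable_funS mf => //; apply: subset_itvr; rewrite bnd_simp.
Qed.

Lemma probability_gt0_setC m : m pos = 1%E -> m (~` pos) = 0%E.
Proof. by move=> m1; rewrite probability_setC// m1 subee. Qed.

Lemma probability_setI_gt0 m (A : set R) : m pos = 1%E -> measurable A ->
  m A = m (A `&` pos).
Proof.
move=> m1 mA; rewrite -[in LHS](setIT A) -(setvU pos) setIUr measureU//; last 3 first.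
- by apply: measurableI => //; exact: measurableC.
- exact: measurableI.
- by rewrite setIACA setIid setICl setI0.
rewrite [X in (X + _)%E](_ : _ = 0%E) ?add0e//.
apply/eqP; rewrite eq_le measure_ge0 andbT -(probability_gt0_setC m1).
by rewrite le_measure ?inE//; [apply: measurableI => //|]; exact: measurableC.
Qed.

Lemma ge0_eq_integral_gt0 m (F G : R -> \bar R) : m pos = 1%E ->
  measurable_fun setT F -> measurable_fun setT G ->
  (forall x, 0 <= F x)%E -> (forall x, 0 <= G x)%E ->
  (forall x, 0 < x -> F x = G x) -> (\int[m]_x F x = \int[m]_x G x)%E.
Proof.
move=> m1 mF mG F0 G0 FG; apply: ge0_ae_eq_integral => //.
exists (~` pos); split; first exact: measurableC.
  exact: probability_gt0_setC.
move=> x /= h; apply: contra_not h => px _; apply: FG.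
by move: px; rewrite /pos/= in_itv/= andbT.
Qed.

Definition pow_mul beta (p : R * R) : R := p.1 `^ beta * p.2.

Lemma measurable_pow_mul beta : measurable_fun setT (pow_mul beta).
Proof.
apply: measurable_funM => //; apply: (measurableT_comp (measurable_powR _)) => //.
Qed.

HB.instance Definition _ beta :=
  isMeasurableFun.Build _ _ _ _ (pow_mul beta) (measurable_pow_mul beta).

(** The equation in law, stated for measures: the exponential variable may live on another
    probability space, with no independent copy of Y_beta at hand. Both laws thus become fixed
    points for the same [kappa]. *)
Definition pow_mul_invariant beta kappa mu : Prop :=
  forall A, measurable A -> (mu \x kappa)%E (pow_mul beta @^-1` A) = mu A.

End fixed_point.

Definition pair_RV (R : realType) (d : measure_display) (T : measurableType d)
  (P : probability T R) (X Y : {RV P >-> R}) (w : T) : R * R := (X w, Y w).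

Lemma measurable_pair_RV (R : realType) (d : measure_display) (T : measurableType d)
  (P : probability T R) (X Y : {RV P >-> R}) : measurable_fun setT (pair_RV X Y).
Proof. by apply/measurable_fun_pairP; split => /=; exact: measurable_funP. Qed.

HB.instance Definition _ (R : realType) (d : measure_display) (T : measurableType d)
  (P : probability T R) (X Y : {RV P >-> R}) :=
  isMeasurableFun.Build _ _ _ _ (pair_RV X Y) (measurable_pair_RV X Y).

Lemma independent_RV_joint (R : realType) (d : measure_display) (T : measurableType d)
    (P : probability T R) (X Y : {RV P >-> R}) (A : set (R * R)) :
  independent_RV X Y -> measurable A ->
  (distribution P X \x distribution P Y)%E A = distribution P (pair_RV X Y) A.
Proof.
move=> XY mA.
apply: (@product_measure_unique _ _ _ _ _ (distribution P X) (distribution P Y)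
  (distribution P (pair_RV X Y))) => //.
Qed.

Lemma eq_law_pow_mul_invariant (R : realType) (d : measure_display)
    (T : measurableType d) (P : probability T R) (X Y : {RV P >-> R}) (beta : R) :
  independent_RV X Y -> eq_law X (powR_RV X beta * Y : {RV P >-> R}) ->
  pow_mul_invariant beta (distribution P Y) (distribution P X).
Proof.
move=> XY law A mA; rewrite independent_RV_joint//; first exact/esym/law.
rewrite -[X in measurable X]setTI; exact: measurable_pow_mul.
Qed.

Lemma pow_mul_gt0_probability (R : realType) (beta : R) (mu kappa : probability R R) :
  mu `]0, +oo[%classic = 1%E -> kappa `]0, +oo[%classic = 1%E ->
  (mu \x kappa)%E (pow_mul beta @^-1` `]0, +oo[) = 1%E.
Proof.
move=> mu1 kappa1; apply/eqP; rewrite eq_le probability_le1 ?andTb; last first.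
  by rewrite -[X in measurable X]setTI; apply: measurable_pow_mul.
rewrite -[leLHS](_ : (mu \x kappa)%E (`]0, +oo[ `*` `]0, +oo[) = 1%E); last first.
  transitivity (mu `]0%R, +oo[%classic * kappa `]0%R, +oo[%classic)%E.
    by apply: product_measure1E; exact: measurable_itv.
  by rewrite mu1 kappa1 mule1.
apply: le_measure; rewrite ?inE.
- by apply: measurableX; exact: measurable_itv.
- by rewrite -[X in measurable X]setTI; apply: measurable_pow_mul => //.
- move=> [y t] /=; rewrite !in_itv/= !andbT => -[y0 t0].
  by rewrite /pow_mul/= mulr_gt0// powR_gt0.
Qed.

(** For fixed t > 0, the event y^beta * t > x is y > (x/t)^(1/beta), of exponential probability
    exp(-(x/t)^(1/beta)). Averaging over t gives [integral_M_Wright_expR]. *)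
Lemma expR_pow_mul_invariant (R : realType) (beta : R)
    (d d' : measure_display) (T : measurableType d) (T' : measurableType d')
    (P : probability T R) (P' : probability T' R)
    (X : {RV P >-> R}) (Y : {RV P' >-> R}) : 0 < beta < 1 ->
  has_density X (fun x => expR (- x)) -> has_density Y (M_Wright beta) ->
  pow_mul_invariant beta (distribution P' Y) (distribution P X).
Proof.
move=> b01 dX dY; have /andP[b0 b1] := b01.
set nu := distribution P X; set kappa := distribution P' Y.
have nu1 : nu `]0, +oo[%classic = 1%E := has_density_gt0 dX.
have kappa1 : kappa `]0, +oo[%classic = 1%E := has_density_gt0 dY.
have mI (x : R) : measurable (pow_mul beta @^-1` `]x, +oo[).
  by rewrite -[X in measurable X]setTI; apply: measurable_pow_mul => //.
move=> A mA.
apply: (@probability_eq_gt _ (distribution (nu \x kappa)%E (pow_mul beta)) nu) => //.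
  exact: pow_mul_gt0_probability.
move=> x x0; rewrite [RHS]distribution_expR_gt ?ltW//.
pose F (t : R) : \bar R := (\int[nu]_y (\1_(pow_mul beta @^-1` `]x, +oo[) (y, t))%:E)%E.
have mind : measurable_fun setT
    (fun z : R * R => (\1_(pow_mul beta @^-1` `]x, +oo[) z)%:E : \bar R).
  by apply/measurable_EFinP; apply: measurable_indic.
transitivity (\int[kappa]_t F t)%E.
  rewrite -(@fubini_tonelli2 _ _ _ _ _ nu kappa
    (fun z => (\1_(pow_mul beta @^-1` `]x, +oo[) z)%:E))//.
  by rewrite integral_indic// setIT.
pose e (t : R) := expR (- (x / t) `^ beta^-1).
have me : measurable_fun setT e.
  apply: measurableT_comp => //.
  by apply: measurableT_comp => //; exact: measurable_ratio_powR.
transitivity (\int[kappa]_t (e t)%:E)%E.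
  apply: ge0_eq_integral_gt0 => //.
  - apply: (measurable_fun_fubini_tonelli_G
      (fun z => (\1_(pow_mul beta @^-1` `]x, +oo[) z)%:E)) => //.
  - exact/measurable_EFinP.
  - by move=> t; apply: integral_ge0 => y _; rewrite lee_fin.
  - by move=> t; rewrite lee_fin expR_ge0.
  - move=> t t0; rewrite /F /e.
    set c := (x / t) `^ beta^-1; have c0 : 0 < c by apply: powR_gt0; rewrite divr_gt0.
    have xt0 : 0 < x / t by rewrite divr_gt0.
    have bb : beta * beta^-1 = 1 by rewrite divff ?gt_eqF.
    have yE (y : R) : 0 < y -> y = (y `^ beta) `^ beta^-1.
      by move=> y0; rewrite -powRrM bb powRr1 ?ltW.
    have cE : x / t = c `^ beta by rewrite /c -powRrM [beta^-1 * _]mulrC bb powRr1 ?ltW.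
    have cE' : c = (x / t) `^ beta^-1 by [].
    clearbody c.
    pose B : set R := [set y | x < y `^ beta * t].
    have mB : measurable B.
      rewrite (_ : B = (fun y => y `^ beta * t) @^-1` `]x, +oo[); last first.
        by apply/seteqP; split => y /=; rewrite in_itv/= andbT.
      rewrite -[X in measurable X]setTI.
      have : measurable_fun setT (fun y : R => y `^ beta * t).
        by apply: measurable_funM => //; exact: measurable_powR.
      by apply => //; exact: measurable_itv.
    transitivity (\int[nu]_y (\1_B y)%:E)%E.
      apply: eq_integral => y _; congr EFin; rewrite !indicE; congr (nat_of_bool _)%:R.
      by apply/idP/idP; rewrite !inE /B/= in_itv/= andbT.
    transitivity (nu B); first by rewrite integral_indic// setIT.
    transitivity (nu (B `&` `]0, +oo[)); first exact: probability_setI_gt0.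
    transitivity (nu `]c, +oo[%classic); last exact: (distribution_expR_gt dX (ltW c0)).
    congr (nu _).
    apply/seteqP; split => y /=; rewrite /B/= !in_itv/= !andbT.
      move=> [xy y0]; rewrite [ltRHS](yE _ y0) cE' gt0_ltr_powR ?invr_gt0 ?nnegrE ?powR_ge0 ?(ltW xt0)//.
      by rewrite ltr_pdivrMr.
    move=> cy; have y0 := lt_trans c0 cy; split => //.
    by rewrite -ltr_pdivrMr// cE gt0_ltr_powR ?nnegrE ?(ltW y0) ?(ltW c0).
rewrite (ge0_integral_has_density dY)//; last by move=> t; rewrite expR_ge0.
have [mM M0 dM] := dY.
rewrite -integral_itv_obnd_cbnd; last first.
  apply/measurable_EFinP; apply: measurable_funM; first exact: measurable_funTS.
  by apply: measurable_funS mM => //; apply: subset_itvr; rewrite bnd_simp.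
rewrite -(integral_M_Wright_expR b01 x0 mM M0); last first.
  by rewrite -(probability_setT kappa) [RHS]dM// setTI.
by apply: eq_integral => t _; rewrite mulrC.
Qed.

(** * Uniqueness of the invariant law *)

Definition lip01 (R : realType) (c : R) (phi : R -> R) : Prop :=
  (forall u, 0 <= phi u <= 1) /\ forall u v, `|phi u - phi v| <= c * `|u - v|.

Lemma lip01_continuous (R : realType) (c : R) (phi : R -> R) :
  lip01 c phi -> continuous phi.
Proof.
move=> [_ lip] x; apply/cvgrPdist_le => e e0.
have c1 : 0 < `|c| + 1 by rewrite ltr_wpDl.
near=> y; apply: (le_trans (lip x y)).
apply: (@le_trans _ _ ((`|c| + 1) * `|x - y|)).
  by rewrite ler_wpM2r// (le_trans (ler_norm c))// lerDl.
rewrite mulrC -ler_pdivlMr//; near: y.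
by apply: cvgr_dist_le => //; rewrite divr_gt0.
Unshelve. all: by end_near. Qed.

Lemma lip01_measurable (R : realType) (c : R) (phi : R -> R) :
  lip01 c phi -> measurable_fun setT phi.
Proof. by move=> /lip01_continuous; exact: continuous_measurable_fun. Qed.

Lemma clamp01_le (R : realType) (p q : R) :
  `|Num.min 1 (Num.max 0 p) - Num.min 1 (Num.max 0 q)| <= `|p - q|.
Proof.
have h1 := ler_norm (p - q); have := ler_norm (q - p); rewrite distrC => h2.
have h0 := normr_ge0 (p - q).
move: h0 h1 h2; set N := `|p - q| => h0 h1 h2; rewrite ler_norml.
case: (leP 0 p) => p0; case: (leP 0 q) => q0;
  rewrite ?[Num.min 1 0]min_r ?ler01//.
- by case: (leP 1 p) => p1; case: (leP 1 q) => q1; apply/andP; split; lra.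
- by case: (leP 1 p) => p1; apply/andP; split; lra.
- by case: (leP 1 q) => q1; apply/andP; split; lra.
- by apply/andP; split; lra.
Qed.

Section uniqueness.
Context {R : realType} (kappa : probability R R) (beta : R)
  (kappa1 : kappa `]0, +oo[%classic = 1%E) (b0 : 0 <= beta).

Let measurable_ln' : measurable_fun setT (@ln R). Proof. exact: measurable_ln. Qed.

Definition log_average (phi : R -> R) (u : R) : R :=
  \int[kappa]_t phi (beta * u + ln t).

Lemma log_averageE (c : R) (phi : R -> R) (u : R) : lip01 c phi ->
  kappa.-integrable setT (fun t => (phi (beta * u + ln t))%:E) /\
  (\int[kappa]_t (phi (beta * u + ln t))%:E = (log_average phi u)%:E)%E.
Proof.
move=> lphi; have [p01 _] := lphi.
have mphi : measurable_fun setT (fun t => phi (beta * u + ln t)).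
  apply: (measurableT_comp (lip01_measurable lphi)).
  by apply: measurable_funD.
have I : kappa.-integrable setT (fun t => (phi (beta * u + ln t))%:E).
  apply: (@le_integrable _ _ _ kappa setT measurableT _ (cst 1%E)).
  - exact/measurable_EFinP.
  - move=> t _; have /andP[p0 p1] := p01 (beta * u + ln t).
    by rewrite /= !ger0_norm// lee_fin.
  - by apply: finite_measure_integrable_cst.
split => //; rewrite /log_average /Rintegral fineK//.
exact: integrable_fin_num.
Qed.

Lemma lip01_log_average (c : R) (phi : R -> R) : 0 <= c ->
  lip01 c phi -> lip01 (beta * c) (log_average phi).
Proof.
move=> c0 lphi; have [p01 plip] := lphi; split.
  move=> u; have [I E] := log_averageE u lphi.
  rewrite -!lee_fin -E; apply/andP; split.
    by apply: integral_ge0 => t _; rewrite lee_fin; have /andP[] := p01 (beta * u + ln t).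
  apply: (@le_trans _ _ (\int[kappa]_t (cst 1%E t))%E).
    apply: ge0_le_integral => //.
    - by move=> t _; rewrite lee_fin; have /andP[] := p01 (beta * u + ln t).
    - by case/integrableP : I.
    - by move=> t _; rewrite lee_fin; have /andP[] := p01 (beta * u + ln t).
  by rewrite integral_cst// mul1e probability_le1.
move=> u v.
have [Iu Eu] := log_averageE u lphi; have [Iv Ev] := log_averageE v lphi.
rewrite -lee_fin.
have -> : (`|log_average phi u - log_average phi v|%R)%:E =
    (`| \int[kappa]_t ((phi (beta * u + ln t))%:E - (phi (beta * v + ln t))%:E) |)%E.
  by rewrite integralB// Eu Ev.
have mB : measurable_fun setT
    (fun t => ((phi (beta * u + ln t))%:E - (phi (beta * v + ln t))%:E)%E).
  by apply: emeasurable_funB; [case/integrableP : Iu|case/integrableP : Iv].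
apply: (le_trans (le_abse_integral kappa measurableT mB)).
pose k := beta * c * `|u - v|.
have k0 : 0 <= k by rewrite !mulr_ge0.
apply: (@le_trans _ _ (\int[kappa]_t (cst k%:E t))%E).
  apply: ge0_le_integral => //.
  - exact: measurableT_comp.
  - move=> t _; rewrite -EFinB /= lee_fin (le_trans (plip _ _))//.
    have -> : beta * u + ln t - (beta * v + ln t) = beta * (u - v) by ring.
    by rewrite normrM (ger0_norm b0) /k -mulrA mulrCA.
rewrite integral_cst//= -[leRHS]mule1 lee_wpmul2l ?lee_fin//.
exact: probability_le1.
Qed.

Lemma integral_log_average (mu : probability R R) (c : R) (phi : R -> R) : 0 <= c ->
  mu `]0, +oo[%classic = 1%E ->
  pow_mul_invariant beta kappa mu -> lip01 c phi ->
  (\int[mu]_y (phi (ln y))%:E = \int[mu]_y (log_average phi (ln y))%:E)%E.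
Proof.
move=> c0 mu1 inv lphi; have [p01 _] := lphi.
have p0 u : 0 <= phi u by have /andP[] := p01 u.
have lL := lip01_log_average c0 lphi.
have mphi := lip01_measurable lphi.
have mpl : measurable_fun setT (fun y => (phi (ln y))%:E).
  by apply/measurable_EFinP; exact: measurableT_comp.
have mL : measurable_fun setT (fun y => (log_average phi (ln y))%:E).
  apply/measurable_EFinP; apply: measurableT_comp => //.
  exact: lip01_measurable lL.
pose f (z : R * R) := (phi (ln (pow_mul beta z)))%:E.
have mf : measurable_fun setT f.
  exact: (measurableT_comp mpl (measurable_pow_mul beta)).
have f0 z : (0 <= f z)%E by rewrite lee_fin.
transitivity (\int[mu \x kappa]_z f z)%E.
  rewrite (@eq_measure_integral _ _ _ setT
    (distribution (mu \x kappa)%E (pow_mul beta))); last first.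
    by move=> A mA _; apply/esym; exact: inv.
  by rewrite ge0_integral_pushforward// => y _; rewrite lee_fin.
rewrite fubini_tonelli1//.
(* The identity ln(y^beta * t) = beta * ln y + ln t requires y, t > 0, hence two reductions to the
   positive half-line, one for each measure. *)
apply: ge0_eq_integral_gt0 => //.
- exact: measurable_fun_fubini_tonelli_F.
- by move=> y; apply: integral_ge0.
- by move=> y; rewrite lee_fin; have /andP[] := lL.1 (ln y).
move=> y y0; rewrite /fubini_F/=.
have [_ <-] := log_averageE (ln y) lphi.
apply: ge0_eq_integral_gt0 => //.
- by apply: (measurableT_comp mf); exact: pair1_measurable.
- apply/measurable_EFinP; apply: (measurableT_comp mphi).
  by apply: measurable_funD.
- by move=> t; rewrite lee_fin.
move=> t t0; rewrite /f /pow_mul/= lnM ?posrE ?powR_gt0//.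
by rewrite ln_powR.
Qed.

(** The sequence on the left does not involve [mu], hence uniqueness. The integral of the n-th
    iterate against [mu] does not depend on n, while the iterate at ln y differs from its value at 0
    by at most beta^n * c * |ln y|. Values in [0, 1] provide the domination, whatever the tails of
    ln y. *)
Lemma cvg_iter_log_average (mu : probability R R) (c : R) (phi : R -> R) :
  beta < 1 -> 0 <= c ->
  mu `]0, +oo[%classic = 1%E -> pow_mul_invariant beta kappa mu -> lip01 c phi ->
  (iter n log_average phi 0)%:E @[n --> \oo] --> (\int[mu]_y (phi (ln y))%:E)%E.
Proof.
move=> b1 c0 mu1 inv lphi.
have lip n : lip01 (beta ^+ n * c) (iter n log_average phi).
  elim: n => [|n IH]; first by rewrite mul1r.
  rewrite exprS -mulrA; apply: lip01_log_average IH.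
  by rewrite mulr_ge0 ?exprn_ge0.
pose I := (\int[mu]_y (phi (ln y))%:E)%E.
have IE n : (\int[mu]_y (iter n log_average phi (ln y))%:E = I)%E.
  elim: n => [//|n IH]; rewrite -IH; apply/esym.
  by apply: (@integral_log_average _ (beta ^+ n * c)) => //; rewrite mulr_ge0 ?exprn_ge0.
have ml n : measurable_fun setT (fun y => iter n log_average phi (ln y)).
  by apply: measurableT_comp => //; exact: lip01_measurable (lip n).
pose f n y := ((iter n log_average phi (ln y) - iter n log_average phi 0)%R)%:E.
have mf n : measurable_fun setT (f n).
  by apply/measurable_EFinP; apply: measurable_funB.
have fint n : mu.-integrable setT (fun y => (iter n log_average phi (ln y))%:E).
  apply: (@le_integrable _ _ _ mu setT measurableT _ (cst 1%E)).
  - exact/measurable_EFinP.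
  - move=> t _; have /andP[p0 p1] := (lip n).1 (ln t).
    by rewrite /= !ger0_norm// lee_fin.
  - by apply: finite_measure_integrable_cst.
have If n : (\int[mu]_y f n y = I - (iter n log_average phi 0)%:E)%E.
  rewrite /f; under eq_integral do rewrite EFinB.
  rewrite integralB//; last exact: finite_measure_integrable_cst.
  rewrite IE; congr (_ - _)%E; rewrite integral_cst// -[RHS]mule1.
  by congr (_ * _)%E; exact: probability_setT.
have Ifin : I \is a fin_num by rewrite -(IE 0%N); exact: integrable_fin_num.
have f0 y : f n y @[n --> \oo] --> 0%E.
  apply: cvg_EFin; first exact: nearW.
  apply/norm_cvg0P.
  have g0 : beta ^+ n * (c * `|ln y - 0|) @[n --> \oo] --> (0 : R).
    rewrite -[X in _ --> X](mul0r (c * `|ln y - 0|)); apply: cvgM; last exact: cvg_cst.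
    by apply: cvg_expr; rewrite ger0_norm.
  apply: (squeeze_cvgr _ (@cvg_cst _ (0 : R) _ _ _) g0); apply: nearW => n.
  by rewrite normr_ge0/= mulrA (lip n).2.
have [_ _] : [/\ mu.-integrable setT (cst 0%E : R -> \bar R),
   [sequence \int[mu]_x `|f n x - 0|]_n @ \oo --> 0%E &
   [sequence \int[mu]_x f n x]_n @ \oo --> (\int[mu]_x 0)%E]%E.
  apply: (@dominated_convergence _ _ _ mu setT measurableT f _ (cst 1%E)) => //.
  - by apply: aeW => y _; exact: f0.
  - by apply: finite_measure_integrable_cst.
  - apply: aeW => y n _; rewrite /f /= lee_fin.
    have /andP[? ?] := (lip n).1 (ln y); have /andP[? ?] := (lip n).1 0.
    by rewrite ler_norml; apply/andP; split; lra.
rewrite integral0 => h.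
have : (I - \int[mu]_x f n x)%E @[n --> \oo] --> (I - 0)%E.
  by apply: cvgeB => //; [rewrite oppe0 fin_num_adde_defl|exact: cvg_cst].
rewrite sube0; apply: cvg_trans; apply: near_eq_cvg; apply: nearW => n.
rewrite /= If -(fineK Ifin) -!EFinB; congr EFin; ring.
Qed.

Lemma pow_mul_invariant_unique (mu nu : probability R R) : beta < 1 ->
  mu `]0, +oo[%classic = 1%E -> nu `]0, +oo[%classic = 1%E ->
  pow_mul_invariant beta kappa mu -> pow_mul_invariant beta kappa nu ->
  forall A, measurable A -> mu A = nu A.
Proof.
move=> b1 mu1 nu1 imu inu; apply: probability_eq_gt => // x x0.
(* A ramp of slope n, from 0 at ln x to 1 at ln x + 1/n for n > 0: a Lipschitz approximation from
   below of the indicator of u > ln x. *)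
pose phi n (u : R) := Num.min 1 (Num.max 0 (n%:R * (u - ln x))).
have lphi n : lip01 n%:R (phi n).
  split.
    move=> u; rewrite /phi le_min ler01 le_max lexx/= ge_min lexx//.
  move=> u v; rewrite /phi.
  have -> : n%:R * `|u - v| = `|n%:R * (u - ln x) - n%:R * (v - ln x)|.
    by rewrite -mulrBr normrM normr_nat; congr (_ * `|_|); ring.
  exact: clamp01_le.
have lim (m : probability R R) : m `]0, +oo[%classic = 1%E ->
    (\int[m]_y (phi n (ln y))%:E)%E @[n --> \oo] --> m `]x, +oo[%classic.
  move=> m1.
  (* Since ln is 0 by default on nonpositive numbers, B contains them when x < 1; only its positive
     part is the ray ]x, +oo[. *)
  pose B : set R := [set y | ln x < ln y].
  have mB : measurable B.
    rewrite (_ : B = @ln R @^-1` `]ln x, +oo[); last first.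
      by apply/seteqP; split => y /=; rewrite in_itv/= andbT.
    rewrite -[X in measurable X]setTI; apply: measurable_ln => //.
  have -> : m `]x, +oo[%classic = (\int[m]_y (\1_B y)%:E)%E.
    rewrite integral_indic// setIT.
    transitivity (m (B `&` `]0, +oo[)); last first.
      by apply/esym; exact: probability_setI_gt0.
    congr (m _); apply/seteqP; split => y /=; rewrite /B/= !in_itv/= !andbT.
      move=> xy; have y0 := lt_trans x0 xy.
      by rewrite y0 ltr_ln ?posrE.
    by move=> [+ y0]; rewrite ltr_ln ?posrE.
  have [_ _] : [/\ m.-integrable setT (fun y => (\1_B y)%:E),
     [sequence \int[m]_y `|(phi n (ln y))%:E - (\1_B y)%:E| ]_n @ \oo --> 0%E &
     [sequence \int[m]_y (phi n (ln y))%:E]_n @ \oo --> (\int[m]_y (\1_B y)%:E)]%E.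
    apply: (@dominated_convergence _ _ _ m setT measurableT _ _ (cst 1%E)) => //.
    - move=> n; apply/measurable_EFinP; apply: measurableT_comp => //.
      exact: lip01_measurable (lphi n).
    - by apply/measurable_EFinP; exact: measurable_indic.
    - apply: aeW => y _; apply: cvg_EFin; first exact: nearW.
      rewrite indicE; case: (boolP (y \in B)) => yB.
        have xy : 0 < ln y - ln x by rewrite subr_gt0; move: yB; rewrite inE.
        apply: cvg_near_cst; near=> n; rewrite /phi.
        have : 1 <= n%:R * (ln y - ln x).
          rewrite -ler_pdivrMr// div1r; near: n; exact: nbhs_infty_ger.
        by move=> h; rewrite /= (max_idPr _) ?(le_trans ler01 h)// (min_idPl _).
      have xy : ln y - ln x <= 0.
        by rewrite subr_le0 leNgt; apply: contra yB; rewrite inE.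
      apply: cvg_near_cst; apply: nearW => n; rewrite /phi.
      by rewrite /= (max_idPl _) ?mulr_ge0_le0// (min_idPr _).
    - by apply: finite_measure_integrable_cst.
    - apply: aeW => y n _; have /andP[p0 p1] := (lphi n).1 (ln y).
      by rewrite /= ger0_norm// lee_fin.
  exact.
have E n : (\int[mu]_y (phi n (ln y))%:E = \int[nu]_y (phi n (ln y))%:E)%E.
  have h1 := cvg_iter_log_average b1 (ler0n _ n) mu1 imu (lphi n).
  have h2 := cvg_iter_log_average b1 (ler0n _ n) nu1 inu (lphi n).
  exact: (cvg_unique _ h1 h2).
have := lim mu mu1; rewrite (funext E) => h.
exact: (cvg_unique _ h (lim nu nu1)).
Unshelve. all: by end_near. Qed.

End uniqueness.

Theorem proposition2p4 (R : realType) (d : measure_display)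
    (T : measurableType d) (P : probability T R)
    (Y Ybeta : {RV P >-> R}) (rhoY : R -> R) (a b beta : R)
    (d0 : measure_display) (T0 : measurableType d0) (P0 : probability T0 R)
    (Y0 : {RV P0 >-> R}) :
  has_density Y rhoY ->
  0 < a -> a < 1 -> 1 < b ->
  (forall z : R[i], a < complex.Re z -> complex.Re z < b ->
    cintegrable `[0, +oo[ (fun x => cpowR x (z - 1) * (rhoY x)%:C)) ->
  0 < beta -> beta < 1 ->
  {ae P, forall w, 0 < Ybeta w} ->
  has_density Ybeta (M_Wright beta) ->
  independent_RV Y Ybeta ->
  eq_law Y (powR_RV Y beta * Ybeta : {RV P >-> R}) ->
  has_density Y0 (fun x => expR (- x)) ->
  eq_law Y Y0.
Proof.
move=> dY _ _ _ _ b0 b1 _ dYb indep law dY0.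
have b01 : 0 < beta < 1 by rewrite b0.
apply: (pow_mul_invariant_unique (has_density_gt0 dYb) (ltW b0) b1
  (has_density_gt0 dY) (has_density_gt0 dY0)).
- exact: eq_law_pow_mul_invariant indep law.
- exact: expR_pow_mul_invariant b01 dY0 dYb.
Qed.
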